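(* Let $A$ be a ribbon quasi-Hopf algebra over a field $K$ with ribbon element $v$, let $\pi:A\to\mathrm{End}(V)$ be a finite-dimensional irreducible representation on which the central element $v$ acts as a scalar, and let $F\in A\otimes A$ be any twistor. For every $n\ge 1$ and every word $\Psi$ in the braid generators and their inverses, let $\Psi$ also denote the operator on $V^{\otimes(n+1)}$ obtained by substituting the operators $\sigma_i^{\pm1}$ of $A$, and let $\Psi^F$ denote the operator obtained from the same word by substituting the operators $(\sigma_i^{F})^{\pm1}$ of the twisted algebra. Then $$\theta_n^F(\Psi)=\theta_n(\Psi),$$ where $\theta_n(\Psi)=\mathrm{tr}\left(\Psi\,\Delta^{(n)}(\beta S(\alpha)uv^{-1})\right)$ and $\theta_n^F(\Psi)=\mathrm{tr}\left(\Psi^F\,\Delta_F^{(n)}(\beta_FS(\alpha_F)uv^{-1})\right)$. Consequently the associated link polynomials coincide: $$(z^+z^-)^{n/2}\left(\frac{z^-}{z^+}\right)^{e(\Psi)/2}\theta^F_n(\Psi)=(z^+z^-)^{n/2}\left(\frac{z^-}{z^+}\right)^{e(\Psi)/2}\theta_n(\Psi),$$ where $z^{\pm}$ is the eigenvalue of $v^{\mp1}$ in $\pi$ and $e(\Psi)$ is the sum of the exponents of the generators appearing in $\Psi$ (with the same choice of square roots on both sides).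
   Context: Summation over repeated indices is understood; $T(a\otimes b)=b\otimes a$, $\Delta^T=T\circ\Delta$, and for $X\in A\otimes A$, $X_{21}=T(X)$. Elements of $A^{\otimes k}$ act on $V^{\otimes k}$ via $\pi^{\otimes k}$, and $\pi$ is omitted from the notation. Quasi-Hopf algebra: a unital associative $K$-algebra $A$ with algebra homomorphisms $\epsilon:A\to K$, $\Delta:A\to A\otimes A$, an invertible $\Phi\in A^{\otimes 3}$, an algebra anti-homomorphism $S:A\to A$ and elements $\alpha,\beta\in A$ such that, for all $a\in A$: $(1\otimes\Delta)\Delta(a)=\Phi^{-1}(\Delta\otimes1)\Delta(a)\Phi$; $(\Delta\otimes1\otimes1)\Phi\cdot(1\otimes1\otimes\Delta)\Phi=(\Phi\otimes1)\cdot(1\otimes\Delta\otimes1)\Phi\cdot(1\otimes\Phi)$; $(\epsilon\otimes1)\Delta=1=(1\otimes\epsilon)\Delta$; $(1\otimes\epsilon\otimes1)\Phi=1$; and, writing $\Delta(a)=\sum a_{(1)}\otimes a_{(2)}$, $\Phi=X_i\otimes Y_i\otimes Z_i$, $\Phi^{-1}=\bar X_i\otimes\bar Y_i\otimes\bar Z_i$: $\sum S(a_{(1)})\alpha a_{(2)}=\epsilon(a)\alpha$, $\sum a_{(1)}\beta S(a_{(2)})=\epsilon(a)\beta$, $\bar X_i\beta S(\bar Y_i)\alpha\bar Z_i=1$, $S(X_i)\alpha Y_i\beta S(Z_i)=1$. Quasi-triangular: there is an invertible $\mathcal{R}=a_\nu\otimes b_\nu\in A\otimes A$ with $\Delta^T(a)\mathcal{R}=\mathcal{R}\Delta(a)$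 for all $a\in A$, $(\Delta\otimes1)\mathcal{R}=\Phi^{-1}_{231}\mathcal{R}_{13}\Phi_{132}\mathcal{R}_{23}\Phi^{-1}_{123}$, $(1\otimes\Delta)\mathcal{R}=\Phi_{312}\mathcal{R}_{13}\Phi^{-1}_{213}\mathcal{R}_{12}\Phi_{123}$. Here $\Phi_{123}=\Phi$, $\Phi_{132}=(1\otimes T)\Phi$, $\Phi_{312}=(T\otimes1)(1\otimes T)\Phi$, $\Phi^{-1}_{213}=(T\otimes1)\Phi^{-1}$, $\Phi^{-1}_{231}=(1\otimes T)(T\otimes1)\Phi^{-1}$. In a quasi-triangular quasi-Hopf algebra put $u=S(Y_i\beta S(Z_i))\,S(b_\nu)\,\alpha\, a_\nu X_i$; it is known that $u$ is invertible and $S^2(a)=uau^{-1}$ for all $a\in A$. Drinfeld twist: write $(\Phi^{-1}\otimes1)\cdot(\Delta\otimes1\otimes1)\Phi=A_i\otimes B_i\otimes C_i\otimes D_i$, $\gamma=S(B_i)\alpha C_i\otimes S(A_i)\alpha D_i$, and $\mathcal{F}=(S\otimes S)\Delta^T(X_i)\cdot\gamma\cdot\Delta(Y_i\beta S(Z_i))$, which is known to be an invertible element of $A\otimes A$. Ribbon quasi-Hopf algebra: a quasi-triangular quasi-Hopf algebra with a central element $v\in A$ (the ribbon element) such that (1) $v^2=uS(u)$; (2) $S(v)=v$; (3) $\epsilon(v)=1$; (4) $\Delta(uv^{-1})=\mathcal{F}^{-1}\cdot(S\otimes S)\mathcal{F}_{21}\cdot(uv^{-1}\otimes uv^{-1})$.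 Twisting: a twistor is an invertible $F=f_i\otimes f^i\in A\otimes A$, with $F^{-1}=\bar f_i\otimes\bar f^i$, such that $(\epsilon\otimes1)F=1=(1\otimes\epsilon)F$. The twisted structure on the algebra $A$ is $\Delta_F(a)=F\Delta(a)F^{-1}$, $\Phi_F=F_{12}\cdot(\Delta\otimes1)F\cdot\Phi\cdot(1\otimes\Delta)F^{-1}\cdot F_{23}^{-1}$, $\mathcal{R}_F=F_{21}\mathcal{R}F^{-1}$, $\alpha_F=S(\bar f_i)\alpha\bar f^i$, $\beta_F=f_i\beta S(f^i)$, with $\epsilon$ and $S$ unchanged; it is again a quasi-triangular quasi-Hopf algebra. The elements $u$ and $v$ used in $\theta^F_n$ are those of the untwisted algebra $A$. Iterated co-products: $\Delta^{(0)}=\mathrm{id}$, $\Delta^{(1)}=\Delta$, $\Delta^{(n)}=\Delta_L\circ\Delta^{(n-1)}$, where $\Delta_L(a\otimes b\otimes\cdots\otimes c)=\Delta(a)\otimes b\otimes\cdots\otimes c$; thus $\Delta^{(n)}:A\to A^{\otimes(n+1)}$. $\Delta_F^{(n)}$ is defined in the same way from $\Delta_F$. Braid generators: let $P$ be the flip on $V\otimes V$, $\check R=P\,(\pi\otimes\pi)\mathcal{R}$, and $\check R_{i(i+1)}$ the operator on $V^{\otimes(n+1)}$ acting as $\check R$ on tensor factors $i,i+1$. Put $\Phi_1=1$ and, for $i\ge2$, $\Phi_i=(\Delta^{(i-2)}\otimes1\otimes1)\Phi\in A^{\otimes(i+1)}$, acting on the first $i+1$ tensor factors. Then $\sigma_i=\Phi_i\check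 R_{i(i+1)}\Phi_i^{-1}$ for $i=1,\dots,n$; these operators satisfy the braid relations. The operators $\sigma_i^F$ are defined in the same way from $\Delta_F,\Phi_F,\mathcal{R}_F$ on the same space $V^{\otimes(n+1)}$. *)

(* Defs.v *)
From HB Require Import structures.
From mathcomp Require Import all_boot all_algebra.
From mathcomp Require Import mxtens.
From mathcomp Require Import boolp classical_sets.

Set Implicit Arguments.
Unset Strict Implicit.
Unset Printing Implicit Defensive.
Set SsrOldRewriteGoalsOrder.

Import GRing.Theory.
Local Open Scope ring_scope.
Local Open Scope quotient_scope.

Definition bilinear_map (K : fieldType) (M N W : lmodType K)
    (f : M -> N -> W) : Prop :=
  (forall n, linear (fun m => f m n)) /\ (forall m, linear (f m)).

Fact linear_at0 (K : fieldType) (M W : lmodType K) (f : M -> W) :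
  linear f -> f 0 = 0.
Proof. by move=> lf; rewrite -(scale0r (0 : M)) (scalable_linear lf) /= scale0r. Qed.

Section TensorDef.
Variables (K : fieldType) (M N : lmodType K).

(* The formal sum [:: (m1, n1); ...; (mk, nk)] stands for
   m1 (x) n1 + ... + mk (x) nk. *)
Local Notation fsum := (seq (M * N)).

Definition fsum_eval (W : lmodType K) (f : M -> N -> W) (s : fsum) : W :=
  \sum_(p <- s) f p.1 p.2.

(* Two formal sums are identified when no bilinear map separates them; the
   quotient is the tensor product, whose universal property is given by
   [tlift_tens], [tlift_linear] and [tlift_unique] below. *)
Definition fsum_eqv (s t : fsum) : bool :=
  `[< forall (W : lmodType K) (f : M -> N -> W), bilinear_map f ->
        fsum_eval f s = fsum_eval f t >].

Lemma fsum_eqv_refl : reflexive fsum_eqv.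
Proof. by move=> s; apply/asboolP. Qed.

Lemma fsum_eqv_sym : symmetric fsum_eqv.
Proof.
by move=> s t; apply/asboolP/asboolP => h W f bf; rewrite h.
Qed.

Lemma fsum_eqv_trans : transitive fsum_eqv.
Proof.
move=> t s r /asboolP h1 /asboolP h2; apply/asboolP => W f bf.
by rewrite h1 // h2.
Qed.

Canonical fsum_equiv := EquivRel fsum_eqv
  fsum_eqv_refl fsum_eqv_sym fsum_eqv_trans.

Definition tensor : Type := {eq_quot fsum_equiv}.
HB.instance Definition _ := Choice.on tensor.
HB.instance Definition _ := Quotient.on tensor.

Definition tens (m : M) (n : N) : tensor := \pi_tensor [:: (m, n)].

(* [tlift f t] is the sum of f m n over the terms m (x) n of t. It is only
   meaningful, i.e. independent of how t is written, for f bilinear. *)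
Definition tlift (W : lmodType K) (f : M -> N -> W) (t : tensor) : W :=
  fsum_eval f (repr t).

Lemma tlift_pi (W : lmodType K) (f : M -> N -> W) s :
  bilinear_map f -> tlift f (\pi_tensor s) = fsum_eval f s.
Proof.
move=> bf; rewrite /tlift.
have /eqmodP/asboolP -> // : repr (\pi_tensor s) = s %[mod tensor].
by rewrite reprK.
Qed.

Lemma tensor_sep (x y : tensor) :
  (forall (W : lmodType K) (f : M -> N -> W), bilinear_map f ->
     tlift f x = tlift f y) -> x = y.
Proof.
move=> h; rewrite -[x]reprK -[y]reprK.
by apply/eqmodP/asboolP => W f bf; exact: h.
Qed.

Definition tens_add (x y : tensor) : tensor := \pi_tensor (repr x ++ repr y).
Definition tens_scale (c : K) (x : tensor) : tensor :=
  \pi_tensor [seq (c *: p.1, p.2) | p <- repr x].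

Lemma tlift_add (W : lmodType K) (f : M -> N -> W) x y :
  bilinear_map f -> tlift f (tens_add x y) = tlift f x + tlift f y.
Proof. by move=> bf; rewrite tlift_pi // /fsum_eval big_cat. Qed.

Lemma tlift_scale (W : lmodType K) (f : M -> N -> W) c x :
  bilinear_map f -> tlift f (tens_scale c x) = c *: tlift f x.
Proof.
move=> bf; rewrite tlift_pi // /fsum_eval big_map scaler_sumr.
by apply: eq_bigr => p _ /=; rewrite (scalable_linear (bf.1 p.2)).
Qed.

Lemma tlift_zero (W : lmodType K) (f : M -> N -> W) :
  bilinear_map f -> tlift f (\pi_tensor [::]) = 0.
Proof. by move=> bf; rewrite tlift_pi // /fsum_eval big_nil. Qed.

Lemma tens_addA : associative tens_add.
Proof. by move=> x y z; apply: tensor_sep => W f bf; rewrite !tlift_add ?addrA. Qed.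

Lemma tens_addC : commutative tens_add.
Proof. by move=> x y; apply: tensor_sep => W f bf; rewrite !tlift_add // addrC. Qed.

Lemma tens_add0 : left_id (\pi_tensor [::]) tens_add.
Proof.
by move=> x; apply: tensor_sep => W f bf; rewrite tlift_add // tlift_zero // add0r.
Qed.

Lemma tens_addN : left_inverse (\pi_tensor [::]) (tens_scale (-1)) tens_add.
Proof.
move=> x; apply: tensor_sep => W f bf.
by rewrite tlift_add // tlift_zero // tlift_scale // scaleN1r addNr.
Qed.

HB.instance Definition _ := GRing.isZmodule.Build tensor
  tens_addA tens_addC tens_add0 tens_addN.

Lemma tens_scaleA a b x :
  tens_scale a (tens_scale b x) = tens_scale (a * b) x.
Proof. by apply: tensor_sep => W f bf; rewrite !tlift_scale // scalerA. Qed.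

Lemma tens_scale1 : left_id 1 tens_scale.
Proof. by move=> x; apply: tensor_sep => W f bf; rewrite tlift_scale // scale1r. Qed.

Lemma tens_scaleDr : right_distributive tens_scale +%R.
Proof.
move=> c x y; apply: tensor_sep => W f bf.
by rewrite tlift_scale // !tlift_add // !tlift_scale // scalerDr.
Qed.

Lemma tens_scaleDl x : {morph tens_scale^~ x : a b / a + b}.
Proof.
move=> a b; apply: tensor_sep => W f bf.
by rewrite tlift_add // !tlift_scale // scalerDl.
Qed.

HB.instance Definition _ := GRing.Zmodule_isLmodule.Build K tensor
  tens_scaleA tens_scale1 tens_scaleDr tens_scaleDl.

Lemma tlift_linear (W : lmodType K) (f : M -> N -> W) :
  bilinear_map f -> linear (tlift f).
Proof. by move=> bf a x y; rewrite tlift_add // tlift_scale. Qed.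

Lemma tlift_tens (W : lmodType K) (f : M -> N -> W) m n :
  bilinear_map f -> tlift f (tens m n) = f m n.
Proof. by move=> bf; rewrite tlift_pi // /fsum_eval big_seq1. Qed.

Lemma tens_bilinear : bilinear_map tens.
Proof.
split=> [n|m] a x y; apply: tensor_sep => W f bf;
  rewrite tlift_add // tlift_scale // !tlift_tens //.
- exact: bf.1.
- exact: bf.2.
Qed.

Lemma tens_sumE (x : tensor) : x = \sum_(p <- repr x) tens p.1 p.2.
Proof.
rewrite -[x in LHS]reprK; elim: (repr x) => [|p s IHs].
  by rewrite big_nil.
rewrite big_cons -IHs; apply: tensor_sep => W f bf.
by rewrite tlift_add // tlift_tens // !tlift_pi // /fsum_eval big_cons.
Qed.

Lemma tensor_ind (P : tensor -> Prop) :
  P 0 -> (forall m n x, P x -> P (tens m n + x)) -> forall x, P x.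
Proof.
move=> P0 PS x; rewrite [x]tens_sumE.
by elim: (repr x) => [|p s IHs]; rewrite ?big_nil // big_cons; apply: PS.
Qed.

Lemma tlift_unique (W : lmodType K) (f g : tensor -> W) :
  linear f -> linear g -> (forall m n, f (tens m n) = g (tens m n)) -> f =1 g.
Proof.
move=> lf lg fg; elim/tensor_ind => [|m n x IHx].
  by rewrite !linear_at0.
by rewrite -[tens m n]scale1r lf lg fg IHx.
Qed.

End TensorDef.

Notation "M ⊗ N" := (tensor M%type N%type)
  (at level 40, left associativity) : type_scope.
Notation "m ⊗ n" := (tens m n)
  (at level 40, left associativity) : ring_scope.

Section Functional.
Variables (K : fieldType) (E : lmodType K) (e : E).

Lemma functional_exists : e != 0 ->
  exists2 phi : E -> K^o, linear phi & phi e = 1.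
Proof.
move=> e0.
pose P (X : set E) := (forall a x y, X x -> X y -> X (a *: x + y)) /\ ~ X e.
have [F FP totF|A [[clA Ae] maxA]] := @Zorn_bigcup E P.
  split=> [a x y [X FX Xx] [Y FY Yy]|[X FX Xe]]; last by case: (FP _ FX).
  have [XY|YX] := totF _ _ FX FY.
    by exists Y => //; apply: (FP _ FY).1 => //; apply: XY.
  by exists X => //; apply: (FP _ FX).1 => //; apply: YX.
have A0 : A 0.
  apply: contrapT => nA0; apply: (maxA [set 0]%classic).
    split=> [x Ax|/(_ 0 erefl)//]; exfalso; apply: nA0.
    by rewrite -(addNr x) -scaleN1r; apply: clA.
  split=> [a x y -> ->|/esym/eqP]; first by rewrite scaler0 addr0.
  by rewrite eq_sym (negPf e0).
have clZ a x : A x -> A (a *: x) by move=> Ax; rewrite -[_ *: _]addr0; apply: clA.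
have clB x y : A x -> A y -> A (x - y).
  by move=> Ax Ay; rewrite addrC -scaleN1r; apply: clA.
have dec x : exists c, A (x - c *: e).
  have [Ax|nAx] := pselect (A x); first by exists 0; rewrite scale0r subr0.
  pose B : set E :=
    [set y | exists2 a, A a & exists c : K, y = a + c *: x]%classic.
  have [[a Aa [c ec]]|nBe] := pselect (B e).
    have c0 : c != 0.
      by apply/eqP => c0; apply: Ae; rewrite ec c0 scale0r addr0.
    exists c^-1; rewrite ec scalerDr scalerA mulVf // scale1r opprD.
    by rewrite addrCA addrN addr0 -scalerN -scaleN1r; apply/clZ/clZ.
  exfalso; apply: (maxA B).
    split=> [y Ay|BA]; first by exists y => //; exists 0; rewrite scale0r addr0.
    by apply/nAx/BA; exists 0 => //; exists 1; rewrite scale1r add0r.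
  split=> // a y z [b Ab [c ->]] [b' Ab' [c' ->]].
  exists (a *: b + b'); first exact: clA.
  by exists (a * c + c'); rewrite scalerDr scalerDl scalerA addrACA.
have uniq_c c c' x : A (x - c *: e) -> A (x - c' *: e) -> c = c'.
  move=> Ac Ac'; apply/eqP; rewrite -subr_eq0; apply/negPn/negP => n0.
  apply: Ae; rewrite -[e]scale1r -(mulVf n0) -scalerA; apply: clZ.
  have -> : (c - c') *: e = (x - c' *: e) - (x - c *: e).
    by rewrite scalerBl opprB [RHS]addrC addrA subrK.
  exact: clB.
pose phi x := projT1 (cid (dec x)).
have phiP x : A (x - phi x *: e) by rewrite /phi; case: cid.
exists phi => [a x y|].
  apply: (uniq_c _ _ (a *: x + y)) => //.
  have -> : a *: x + y - (a *: (phi x : K^o) + phi y) *: e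
      = a *: (x - phi x *: e) + (y - phi y *: e).
    by rewrite scalerDl scalerBr scalerA opprD addrACA.
  exact: clA.
by apply: (uniq_c _ _ e) => //; rewrite scale1r subrr.
Qed.

End Functional.

Section TensorAlgebra.
Variables (K : fieldType) (A B : algType K).
Implicit Types x y z : A ⊗ B.

Definition tens_one : A ⊗ B := 1 ⊗ 1.
Definition tens_mul x y : A ⊗ B :=
  tlift (fun a b => tlift (fun a' b' => (a * a') ⊗ (b * b')) y) x.

Fact tens_mul_bilin1 a b :
  bilinear_map (fun (a' : A) (b' : B) => (a * a') ⊗ (b * b')).
Proof.
split=> [b'|a'] c u v; rewrite mulrDr -scalerAr;
  [exact: (tens_bilinear A B).1 | exact: (tens_bilinear A B).2].
Qed.

Fact tens_mul_bilin2 y : bilinear_map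
  (fun a b => tlift (fun a' b' => (a * a') ⊗ (b * b')) y : A ⊗ B).
Proof.
split=> [b|a] c u v; elim/tensor_ind: y => [|a' b' y IHy].
- by rewrite !(linear_at0 (tlift_linear (tens_mul_bilin1 _ _))) scaler0 addr0.
- rewrite -[a' ⊗ b']scale1r !(tlift_linear (tens_mul_bilin1 _ _)) IHy.
  rewrite !tlift_tens; do ?exact: tens_mul_bilin1.
  rewrite !scale1r mulrDl -scalerAl (tens_bilinear A B).1.
  by rewrite scalerDr addrACA.
- by rewrite !(linear_at0 (tlift_linear (tens_mul_bilin1 _ _))) scaler0 addr0.
- rewrite -[a' ⊗ b']scale1r !(tlift_linear (tens_mul_bilin1 _ _)) IHy.
  rewrite !tlift_tens; do ?exact: tens_mul_bilin1.
  rewrite !scale1r mulrDl -scalerAl (tens_bilinear A B).2.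
  by rewrite scalerDr addrACA.
Qed.

Fact tens_mul_tens a b a' b' :
  tens_mul (a ⊗ b) (a' ⊗ b') = (a * a') ⊗ (b * b').
Proof.
by rewrite /tens_mul tlift_tens ?tlift_tens //;
  [exact: tens_mul_bilin1 | exact: tens_mul_bilin2].
Qed.

Fact tens_mul_linl y : linear (tens_mul^~ y).
Proof. exact/tlift_linear/tens_mul_bilin2. Qed.

Fact tens_mul_linr x : linear (tens_mul x).
Proof.
move=> c y z; elim/tensor_ind: x => [|a b x IHx].
  by rewrite !(linear_at0 (tens_mul_linl _)) scaler0 addr0.
rewrite -[a ⊗ b]scale1r !tens_mul_linl IHx !scale1r /tens_mul.
rewrite !tlift_tens; do ?exact: tens_mul_bilin2.
rewrite (tlift_linear (tens_mul_bilin1 _ _)).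
by rewrite scalerDr addrACA.
Qed.

Fact tens_mul0l y : tens_mul 0 y = 0.
Proof. exact/linear_at0/tens_mul_linl. Qed.

Fact tens_mul0r x : tens_mul x 0 = 0.
Proof. exact/linear_at0/tens_mul_linr. Qed.

Fact tens_mulDl : left_distributive tens_mul +%R.
Proof. by move=> x y z; rewrite -[x]scale1r tens_mul_linl !scale1r. Qed.

Fact tens_mulDr : right_distributive tens_mul +%R.
Proof. by move=> x y z; rewrite -[y]scale1r tens_mul_linr !scale1r. Qed.

Fact tens_mulA : associative tens_mul.
Proof.
move=> x y z.
elim/tensor_ind: x => [|a b x IHx]; first by rewrite !tens_mul0l.
rewrite !tens_mulDl IHx; congr (_ + _) => {x IHx}.
elim/tensor_ind: y => [|a' b' y IHy]; first by rewrite !(tens_mul0l, tens_mul0r).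
rewrite !(tens_mulDl, tens_mulDr) IHy; congr (_ + _) => {y IHy}.
elim/tensor_ind: z => [|a'' b'' z IHz]; first by rewrite !tens_mul0r.
by rewrite !tens_mulDr IHz; congr (_ + _); rewrite !tens_mul_tens !mulrA.
Qed.

Fact tens_mul1l : left_id tens_one tens_mul.
Proof.
elim/tensor_ind => [|a b x IHx]; first by rewrite tens_mul0r.
by rewrite tens_mulDr IHx tens_mul_tens !mul1r.
Qed.

Fact tens_mul1r : right_id tens_one tens_mul.
Proof.
elim/tensor_ind => [|a b x IHx]; first by rewrite tens_mul0l.
by rewrite tens_mulDl IHx tens_mul_tens !mulr1.
Qed.

Fact tens_one_neq0 : tens_one != 0.
Proof.
have [f lf f1] := functional_exists (oner_neq0 A).
have [g lg g1] := functional_exists (oner_neq0 B).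
pose h (a : A) (b : B) : K^o := f a * g b.
have bh : bilinear_map h.
  split=> [b|a] c u v; rewrite /h ?lf ?lg.
    by rewrite mulrDl -scalerAl.
  by rewrite mulrDr -scalerAr.
apply/eqP => /(congr1 (tlift h)); rewrite tlift_tens // /h f1 g1 mulr1.
rewrite (linear_at0 (tlift_linear bh)).
by move/eqP; rewrite oner_eq0.
Qed.

HB.instance Definition _ := GRing.Zmodule_isNzRing.Build (tensor A B)
  tens_mulA tens_mul1l tens_mul1r tens_mulDl tens_mulDr tens_one_neq0.

Fact tens_scaleAl (c : K) x y : c *: (x * y) = (c *: x) * y.
Proof. by rewrite -[RHS]/(tens_mul _ _) (scalable_linear (tens_mul_linl _)). Qed.

HB.instance Definition _ :=
  GRing.Lmodule_isLalgebra.Build K (tensor A B) tens_scaleAl.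

Fact tens_scaleAr (c : K) x y : c *: (x * y) = x * (c *: y).
Proof. by rewrite -[RHS]/(tens_mul _ _) (scalable_linear (tens_mul_linr _)). Qed.

HB.instance Definition _ :=
  GRing.Lalgebra_isAlgebra.Build K (tensor A B) tens_scaleAr.

(* Inverses in A ⊗ B, obtained from the axiom of choice. *)
Definition tens_unit : pred (A ⊗ B) :=
  fun x => `[< exists y, y * x = 1 /\ x * y = 1 >].
Definition tens_inv x : A ⊗ B :=
  if pselect (exists y, y * x = 1 /\ x * y = 1) is left h
  then projT1 (cid h) else x.

Fact tens_mulV : {in tens_unit, left_inverse 1 tens_inv *%R}.
Proof.
by move=> x /asboolP ux; rewrite /tens_inv; case: pselect => // h; case: cid => ? [].
Qed.

Fact tens_divV : {in tens_unit, right_inverse 1 tens_inv *%R}.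
Proof.
by move=> x /asboolP ux; rewrite /tens_inv; case: pselect => // h; case: cid => ? [].
Qed.

Fact tens_unitP x y : y * x = 1 /\ x * y = 1 -> tens_unit x.
Proof. by move=> h; apply/asboolP; exists y. Qed.

Fact tens_inv_out : {in [predC tens_unit], tens_inv =1 id}.
Proof.
move=> x /negP nux; rewrite /tens_inv; case: pselect => // h.
by case: nux; apply/asboolP.
Qed.

HB.instance Definition _ := GRing.NzRing_hasMulInverse.Build (tensor A B)
  tens_mulV tens_divV tens_unitP tens_inv_out.

End TensorAlgebra.

Section TensorMaps.
Variable K : fieldType.

Definition tmap (M N M' N' : lmodType K) (f : M -> M') (g : N -> N') :
    M ⊗ N -> M' ⊗ N' :=
  tlift (fun m n => f m ⊗ g n).

Definition tswap (M N : lmodType K) : M ⊗ N -> N ⊗ M :=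
  tlift (fun m n => n ⊗ m).

Definition tswap_right (M N P : lmodType K) : M ⊗ N ⊗ P -> M ⊗ P ⊗ N :=
  tlift (fun mn p => tlift (fun m n => m ⊗ p ⊗ n) mn).

Definition tassoc (M N P : lmodType K) : M ⊗ (N ⊗ P) -> M ⊗ N ⊗ P :=
  tlift (fun m np => tlift (fun n p => m ⊗ n ⊗ p) np).

Definition tlift3 (M N P W : lmodType K) (f : M -> N -> P -> W) :
    M ⊗ N ⊗ P -> W :=
  tlift (fun mn p => tlift (fun m n => f m n p) mn).

Definition tlift4 (M N P Q W : lmodType K) (f : M -> N -> P -> Q -> W) :
    M ⊗ N ⊗ P ⊗ Q -> W :=
  tlift (fun mnp q => tlift3 (fun m n p => f m n p q) mnp).

End TensorMaps.

(* The operations of a quasi-triangular quasi-Hopf algebra. In classical logic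
   every unital associative algebra is a [unitAlgType], whose ^-1 is the inverse
   on the invertible elements. Tensor powers are nested to the left. *)
Record qha_data (K : fieldType) (A : unitAlgType K) := QhaData {
  copr : A -> A ⊗ A;
  counit : A -> K^o;
  coassoc : A ⊗ A ⊗ A;
  antip : A -> A;
  qalpha : A;
  qbeta : A;
  rmatrix : A ⊗ A
}.

Definition alg_hom (K : fieldType) (A B : algType K) (f : A -> B) : Prop :=
  [/\ linear f, f 1 = 1 & {morph f : a b / a * b}].

Definition alg_antihom (K : fieldType) (A B : algType K) (f : A -> B) : Prop :=
  [/\ linear f, f 1 = 1 & forall a b, f (a * b) = f b * f a].

Section QuasiHopf.
Variables (K : fieldType) (A : unitAlgType K) (H : qha_data A).

Local Notation Δ := (copr H).
Local Notation ε := (counit H).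
Local Notation Φ := (coassoc H).
Local Notation S := (antip H).
Local Notation α := (qalpha H).
Local Notation β := (qbeta H).
Local Notation R := (rmatrix H).

Definition copr_op (a : A) : A ⊗ A := tswap (Δ a).

(* (Δ⊗1), (1⊗Δ) on A⊗A; (Δ⊗1⊗1), (1⊗Δ⊗1), (1⊗1⊗Δ) on A⊗A⊗A *)
Definition copr_l : A ⊗ A -> A ⊗ A ⊗ A := tmap Δ id.
Definition copr_r : A ⊗ A -> A ⊗ A ⊗ A := fun x => tassoc (tmap id Δ x).
Definition copr_l3 : A ⊗ A ⊗ A -> A ⊗ A ⊗ A ⊗ A := tmap copr_l id.
Definition copr_m3 : A ⊗ A ⊗ A -> A ⊗ A ⊗ A ⊗ A := tmap copr_r id.
Definition copr_r3 : A ⊗ A ⊗ A -> A ⊗ A ⊗ A ⊗ A :=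
  fun x => tassoc (tmap id Δ x).

(* (ε⊗1), (1⊗ε) *)
Definition counit_l : A ⊗ A -> A := tlift (fun a b => ε a *: b).
Definition counit_r : A ⊗ A -> A := tlift (fun a b => ε b *: a).

(* x ↦ 1⊗x *)
Definition pad_l3 : A ⊗ A ⊗ A -> A ⊗ A ⊗ A ⊗ A :=
  tmap (tmap (fun a : A => (1 : A) ⊗ a) id) id.

Record quasi_hopf : Prop := QuasiHopf {
  counit_hom : alg_hom ε;
  copr_hom : alg_hom Δ;
  antip_antihom : alg_antihom S;
  coassoc_unit : Φ \is a GRing.unit;
  quasi_coassoc : forall a, copr_r (Δ a) = Φ^-1 * copr_l (Δ a) * Φ;
  pentagon :
    copr_l3 Φ * copr_r3 Φ = (Φ ⊗ 1) * copr_m3 Φ * pad_l3 Φ;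
  counit_copr_l : forall a, counit_l (Δ a) = a;
  counit_copr_r : forall a, counit_r (Δ a) = a;
  counit_coassoc : tmap counit_r id Φ = 1;
  antip_alpha : forall a, tlift (fun x y => S x * α * y) (Δ a) = ε a *: α;
  antip_beta : forall a, tlift (fun x y => x * β * S y) (Δ a) = ε a *: β;
  antip_coassocV : tlift3 (fun x y z => x * β * S y * α * z) Φ^-1 = 1;
  antip_coassoc : tlift3 (fun x y z => S x * α * y * β * S z) Φ = 1
}.

Definition tens12 (x : A ⊗ A) : A ⊗ A ⊗ A := x ⊗ 1.
Definition tens13 (x : A ⊗ A) : A ⊗ A ⊗ A :=
  tmap (fun a : A => a ⊗ (1 : A)) id x.
Definition tens23 (x : A ⊗ A) : A ⊗ A ⊗ A :=
  tmap (fun a : A => (1 : A) ⊗ a) id x.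

(* (T⊗1), (1⊗T) on A⊗A⊗A *)
Definition swap12 : A ⊗ A ⊗ A -> A ⊗ A ⊗ A := tmap (@tswap K A A) id.
Definition swap23 : A ⊗ A ⊗ A -> A ⊗ A ⊗ A := @tswap_right K A A A.

Record quasi_triangular : Prop := QuasiTriangular {
  rmatrix_unit : R \is a GRing.unit;
  rmatrix_copr : forall a, copr_op a * R = R * Δ a;
  hexagon_l :
    copr_l R = swap23 (swap12 Φ^-1) * tens13 R * swap23 Φ * tens23 R * Φ^-1;
  hexagon_r :
    copr_r R = swap12 (swap23 Φ) * tens13 R * swap12 Φ^-1 * tens12 R * Φ
}.

Definition drinfeld_u : A :=
  tlift3 (fun x y z =>
    tlift (fun a b => S (y * β * S z) * S b * α * a * x) R) Φ.

Definition drinfeld_gamma : A ⊗ A :=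
  tlift4 (fun a b c d => (S b * α * c) ⊗ (S a * α * d))
    ((Φ^-1 ⊗ 1) * copr_l3 Φ).

Definition drinfeld_twist : A ⊗ A :=
  tlift3 (fun x y z =>
    tmap S S (copr_op x) * drinfeld_gamma * Δ (y * β * S z)) Φ.

Record ribbon (v : A) : Prop := Ribbon {
  ribbon_central : forall a, v * a = a * v;
  ribbon_sqr : v ^+ 2 = drinfeld_u * S drinfeld_u;
  ribbon_antip : S v = v;
  ribbon_counit : ε v = 1;
  ribbon_copr : Δ (drinfeld_u / v) =
    drinfeld_twist^-1 * tmap S S (tswap drinfeld_twist) *
    ((drinfeld_u / v) ⊗ (drinfeld_u / v))
}.

Record twistor (F : A ⊗ A) : Prop := Twistor {
  twistor_unit : F \is a GRing.unit;
  twistor_counit_l : counit_l F = 1;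
  twistor_counit_r : counit_r F = 1
}.

Definition twist (F : A ⊗ A) : qha_data A := {|
  copr := fun a => F * Δ a * F^-1;
  counit := ε;
  coassoc := tens12 F * copr_l F * Φ * copr_r F^-1 * (tens23 F)^-1;
  antip := S;
  qalpha := tlift (fun x y => S x * α * y) F^-1;
  qbeta := tlift (fun x y => x * β * S y) F;
  rmatrix := tswap F * R * F^-1
|}.

(* tpow n is the tensor power of A with n + 1 factors. *)
Fixpoint tpow (n : nat) : unitAlgType K :=
  if n is m.+1 then (tensor (tpow m) A : unitAlgType K) else A.

Fixpoint copr_head (n : nat) : tpow n -> tpow n.+1 :=
  if n is m.+1 then tmap (@copr_head m) (@id A) else Δ.

Fixpoint copr_iter (n : nat) : A -> tpow n :=
  if n is m.+1 then fun a => copr_head (copr_iter m a) else id.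

(* Φ_i, in the tensor power with i + 1 factors *)
Definition coassoc_iter (i : nat) : tpow i :=
  match i with
  | k.+2 => tmap (tmap (copr_iter k) (@id A)) (@id A) Φ
  | _ => 1
  end.

(* Φ_i ⊗ 1 ⊗ ... ⊗ 1 in the tensor power with n + 1 factors, for 1 <= i <= n *)
Fixpoint coassoc_at (n i : nat) : tpow n :=
  if n is m.+1 then
    if i == m.+1 then coassoc_iter m.+1 else coassoc_at m i ⊗ (1 : A)
  else 1.

End QuasiHopf.

(* The dimension of the tensor power with n + 1 factors of a d-dimensional
   space; operators on it are matrices acting on column vectors, and the tensor
   product of operators is the Kronecker product *t. *)
Fixpoint tdim (d n : nat) : nat := if n is m.+1 then (tdim d m * d)%N else d.

Section Operators.
Variables (K : fieldType) (d : nat).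

Definition flip_mx : 'M[K]_(d * d) :=
  \sum_(i < d) \sum_(j < d) (delta_mx i j : 'M[K]_d) *t (delta_mx j i : 'M[K]_d).

Definition last_two (X : 'M[K]_(d * d)) (m : nat) : 'M[K]_(tdim d m.+1) :=
  match m with
  | 0 => X
  | k.+1 => castmx (mulnA _ _ _, mulnA _ _ _) ((1%:M : 'M[K]_(tdim d k)) *t X)
  end.

(* X acting on the factors i, i + 1 (counted from 1) among n + 1 factors,
   for 1 <= i <= n *)
Fixpoint two_site (X : 'M[K]_(d * d)) (n i : nat) : 'M[K]_(tdim d n) :=
  if n is m.+1 then
    if i == m.+1 then last_two X m else two_site X m i *t (1%:M : 'M[K]_d)
  else 1%:M.

End Operators.

Section Braid.
Variables (K : fieldType) (A : unitAlgType K) (d : nat).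
Variable pi : A -> 'M[K]_d.

Definition irreducible : Prop := (0 < d)%N /\
  forall U : {vspace 'cV[K]_d},
    (forall a x, x \in U -> pi a *m x \in U) -> U = 0%VS \/ U = fullv.

Fixpoint tpow_rep (n : nat) : tpow A n -> 'M[K]_(tdim d n) :=
  if n is m.+1 then tlift (fun x a => @tpow_rep m x *t pi a) else pi.

Variable H : qha_data A.

Definition rcheck : 'M[K]_(d * d) :=
  flip_mx K d *m tlift (fun a b => pi a *t pi b) (rmatrix H).

Definition braid_gen (n i : nat) : 'M[K]_(tdim d n) :=
  tpow_rep (coassoc_at H n i) *m two_site rcheck n i
    *m tpow_rep (coassoc_at H n i)^-1.

End Braid.

(* The letter (i, false) stands for the generator σ_(i+1) and (i, true) for its
   inverse. *)
Definition braid_word (n : nat) : Type := seq ('I_n * bool).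

Definition exponent_sum (n : nat) (w : braid_word n) : int :=
  \sum_(g <- w) (-1) ^+ g.2.

Section Invariants.
Variables (K : fieldType) (A : unitAlgType K) (d : nat).
Variable pi : A -> 'M[K]_d.

Definition word_op (H : qha_data A) (n : nat) (w : braid_word n) :
    'M[K]_(tdim d n) :=
  \big[mulmx/1%:M]_(g <- w)
    (let s := braid_gen pi H n g.1.+1 in if g.2 then invmx s else s).

(* g stands for u v^-1, computed in the untwisted algebra even when H is a twist. *)
Definition theta (H : qha_data A) (g : A) (n : nat) (w : braid_word n) : K :=
  \tr (word_op H w *m
       tpow_rep pi (copr_iter H n (qbeta H * antip H (qalpha H) * g))).

(* p and q are the chosen square roots of z+ z- and z- / z+. *)
Definition link_poly (p q : K) (H : qha_data A) (g : A) (n : nat)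
    (w : braid_word n) : K :=
  p ^+ n * q ^ exponent_sum w * theta H g w.

End Invariants.

(* Main.v *)
(* Put G_0 = 1 and G_(n+1) = (G_n ⊗ 1) (Δ^(n) ⊗ 1)F. Then
   Δ_F^(n)(a) = G_n Δ^(n)(a) G_n^-1, and since Ř_F = F Ř F^-1 while Ř commutes
   with Δ(A), also σ_i^F = G_n σ_i G_n^-1. So it suffices to compare
   tr(Ψ Δ^(n)(b)) for b = β_F S(α_F) u v^-1 and b = β S(α) u v^-1. By
   quasi-coassociativity Ψ commutes with Δ^(n)(A), so χ(b) = tr(Ψ Δ^(n)(b))
   satisfies χ(ab) = χ(ba); with S^2(a) u = u a this gives
     χ(f_i β S(f^i) S(\bar f^j) S(α) S^2(\bar f_j) u v^-1)
       = χ(\bar f_j f_i β S(\bar f^j f^i) S(α) u v^-1) = χ(β S(α) u v^-1). *)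

Require Import Defs.
From HB Require Import structures.
From mathcomp Require Import all_boot all_algebra.
From mathcomp Require Import mxtens.

Set Implicit Arguments.
Unset Strict Implicit.
Unset Printing Implicit Defensive.

Import GRing.Theory.
Local Open Scope ring_scope.

(** The generators fall under two different arguments. For i < n, σ_i is σ_i on n factors tensored
    with 1, and it has to pass the factor (Δ^(n-1) ⊗ 1)F of G_n. This already requires that σ_i
    commute with Δ^(n-1)(A), so commutation with iterated coproducts serves twice: here and for the
    cyclicity of χ. The last generator does not come from fewer factors. For n >= 2 the twisted Φ_n
    factors as G_n Φ_n W^-1, where W is the product of G_(n-2) on the other factors, F on the last
    two, and (Δ^(n-2) ⊗ Δ)F. Only the middle factor of W turns Ř_F into Ř; the outer two commute
    with R-matrices on the last two factors. Maps on a tensor product are plain functions evaluated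
    on a chosen representative. An identity between them is therefore obtained by proving both sides
    linear and comparing them on pure tensors; to make this possible, Δ(a), F and F^-1 are first
    replaced by arbitrary tensors. *)

Section LinearMaps.
Variables (K : fieldType) (M N W : lmodType K).

Lemma linear_addE (f : M -> W) : linear f -> {morph f : x y / x + y}.
Proof. by move=> lf x y; rewrite -[x]scale1r lf !scale1r. Qed.

Lemma linear_scaleE (f : M -> W) : linear f -> forall c, {morph f : x / c *: x}.
Proof. by move=> lf c x; rewrite (scalable_linear lf). Qed.

Lemma linear_id : linear (@id M).
Proof. by []. Qed.

Lemma linear_comp (f : N -> W) (g : M -> N) :
  linear f -> linear g -> linear (fun x => f (g x)).
Proof. by move=> lf lg c x y; rewrite lg lf. Qed.

End LinearMaps.

(** * Multilinear maps and identities checked on pure tensors *)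

Section Multilinear.
Variables (K : fieldType) (M N P W : lmodType K).

Lemma tensor_linear_ext2 (M' N' : lmodType K) (f g : M ⊗ N -> M' ⊗ N' -> W) :
  bilinear_map f -> bilinear_map g ->
  (forall m n m' n', f (m ⊗ n) (m' ⊗ n') = g (m ⊗ n) (m' ⊗ n')) ->
  forall x y, f x y = g x y.
Proof.
move=> [fl fr] [gl gr] fg x y.
apply: (tlift_unique (fl y) (gl y)) => m n.
exact: (tlift_unique (fr _) (gr _)).
Qed.

(** Here the tensor is fixed and the parameter varies, so the linearity of [tlift] in its tensor
    says nothing; the proof is by induction on [t] as a finite sum of pure tensors. This is what
    makes iterated lifts such as [tlift3] well defined. *)
Lemma tlift_linear_param (f : M -> N -> P -> W) t :
  (forall p, bilinear_map (fun m n => f m n p)) ->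
  (forall m n, linear (f m n)) ->
  linear (fun p => tlift (fun m n => f m n p) t).
Proof.
move=> bf lf c p q; elim/tensor_ind: t => [|m n t IHt].
  by rewrite !(linear_at0 (tlift_linear (bf _))) scaler0 addr0.
rewrite !(linear_addE (tlift_linear (bf _))) IHt !(tlift_tens _ _ (bf _)) lf.
by rewrite scalerDr addrACA.
Qed.

Lemma tlift_bilinear (f : M -> N -> P -> W) :
  (forall p, bilinear_map (fun m n => f m n p)) ->
  (forall m n, linear (f m n)) ->
  bilinear_map (fun t p => tlift (fun m n => f m n p) t).
Proof.
by move=> bf lf; split=> [p|t]; [exact: tlift_linear|exact: tlift_linear_param].
Qed.

Lemma tlift3_linear (f : M -> N -> P -> W) :
  (forall p, bilinear_map (fun m n => f m n p)) ->
  (forall m n, linear (f m n)) -> linear (tlift3 f).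
Proof. by move=> bf lf; apply/tlift_linear/tlift_bilinear. Qed.

Lemma tlift3_tens (f : M -> N -> P -> W) m n p :
  (forall p, bilinear_map (fun m n => f m n p)) ->
  (forall m n, linear (f m n)) -> tlift3 f (m ⊗ n ⊗ p) = f m n p.
Proof.
move=> bf lf; rewrite /tlift3 tlift_tens; last exact: tlift_bilinear.
by rewrite tlift_tens.
Qed.

End Multilinear.

Lemma tensDl (K : fieldType) (M N : lmodType K) (n : N) :
  {morph (fun m : M => m ⊗ n) : x y / x + y}.
Proof. exact: linear_addE ((tens_bilinear M N).1 n). Qed.

Lemma tensDr (K : fieldType) (M N : lmodType K) (m : M) :
  {morph (fun n : N => m ⊗ n) : x y / x + y}.
Proof. exact: linear_addE ((tens_bilinear M N).2 m). Qed.

Lemma tensZl (K : fieldType) (M N : lmodType K) c (m : M) (n : N) :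
  (c *: m) ⊗ n = c *: (m ⊗ n).
Proof. exact: (linear_scaleE ((tens_bilinear M N).1 n)). Qed.

Lemma tensZr (K : fieldType) (M N : lmodType K) c (m : M) (n : N) :
  m ⊗ (c *: n) = c *: (m ⊗ n).
Proof. exact: (linear_scaleE ((tens_bilinear M N).2 m)). Qed.

Lemma tlift_comp (K : fieldType) (M N W W' : lmodType K) (g : W -> W')
    (f : M -> N -> W) : linear g -> bilinear_map f ->
  forall t, g (tlift f t) = tlift (fun m n => g (f m n)) t.
Proof.
move=> lg bf; have bgf : bilinear_map (fun m n => g (f m n)).
  by split=> [n|m]; apply: (linear_comp lg); [exact: bf.1|exact: bf.2].
apply: tlift_unique => [||m n]; last by rewrite !tlift_tens.
- exact: (linear_comp lg (tlift_linear bf)).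
- exact: tlift_linear.
Qed.

Section TensorMapTheory.
Variables (K : fieldType) (M N M' N' : lmodType K).

Lemma tmap_bilinear (f : M -> M') (g : N -> N') :
  linear f -> linear g -> bilinear_map (fun m n => f m ⊗ g n).
Proof.
by move=> lf lg; split=> [n|m] c x y; rewrite ?lf ?lg ?tensDl ?tensDr ?tensZl ?tensZr.
Qed.

Lemma tmap_linear (f : M -> M') (g : N -> N') :
  linear f -> linear g -> linear (tmap f g).
Proof. by move=> lf lg; apply/tlift_linear/tmap_bilinear. Qed.

Lemma tmap_tens (f : M -> M') (g : N -> N') m n :
  linear f -> linear g -> tmap f g (m ⊗ n) = f m ⊗ g n.
Proof. by move=> lf lg; rewrite /tmap tlift_tens //; apply: tmap_bilinear. Qed.

(** Both sides unfold to sums over the same representative of [x], hence agree term by term. *)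
Lemma tmap_eq (f f' : M -> M') (g g' : N -> N') x :
  f =1 f' -> g =1 g' -> tmap f g x = tmap f' g' x.
Proof. by move=> ff gg; apply: eq_bigr => p _; rewrite ff gg. Qed.

End TensorMapTheory.

Section TensorMapFunctor.
Variables (K : fieldType) (M N : lmodType K).

Lemma tmap_id x : tmap (@id M) (@id N) x = x.
Proof.
move: x; apply: tlift_unique => // [|m n]; first exact: tmap_linear.
by rewrite tmap_tens.
Qed.

Lemma tmap_comp (M' N' M'' N'' : lmodType K) (f : M -> M') (g : N -> N')
    (f' : M' -> M'') (g' : N' -> N'') x :
  linear f -> linear g -> linear f' -> linear g' ->
  tmap f' g' (tmap f g x) = tmap (fun a => f' (f a)) (fun b => g' (g b)) x.
Proof.
move=> lf lg lf' lg'; move: x; have l1 := linear_comp lf' lf.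
have l2 := linear_comp lg' lg.
apply: tlift_unique => [||m n].
- exact: (linear_comp (tmap_linear lf' lg') (tmap_linear lf lg)).
- exact: tmap_linear.
- by rewrite !tmap_tens.
Qed.

Lemma tswap_bilinear : bilinear_map (fun (m : M) (n : N) => n ⊗ m).
Proof. by split=> [n|m] c x y; rewrite ?tensDl ?tensDr ?tensZl ?tensZr. Qed.

Lemma tswap_linear : linear (@tswap K M N).
Proof. exact/tlift_linear/tswap_bilinear. Qed.

Lemma tswap_tens (m : M) (n : N) : tswap (m ⊗ n) = n ⊗ m.
Proof. by rewrite /tswap tlift_tens //; apply: tswap_bilinear. Qed.

End TensorMapFunctor.

Lemma tswapK (K : fieldType) (M N : lmodType K) :
  cancel (@tswap K M N) (@tswap K N M).
Proof.
apply: tlift_unique => [||m n]; last by rewrite !tswap_tens.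
  exact: (linear_comp (@tswap_linear _ _ _) (@tswap_linear _ _ _)).
exact: linear_id.
Qed.

Section Associator.
Variables (K : fieldType) (M N P : lmodType K).

Lemma tassoc_bilinear :
  bilinear_map (fun (m : M) (t : N ⊗ P) => tmap (fun n => m ⊗ n) id t).
Proof.
have lr m : linear (fun n : N => m ⊗ n) := (tens_bilinear M N).2 m.
split=> [t|m]; last exact: tmap_linear.
apply: tlift_linear_param => [m|n p]; first exact: tmap_bilinear.
exact: linear_comp ((tens_bilinear _ _).1 p) ((tens_bilinear _ _).1 n).
Qed.

Lemma tassoc_linear : linear (@tassoc K M N P).
Proof. exact: tlift_linear tassoc_bilinear. Qed.

Lemma tassoc_tens (m : M) (t : N ⊗ P) :
  tassoc (m ⊗ t) = tmap (fun n => m ⊗ n) id t.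
Proof. by rewrite /tassoc tlift_tens //; exact: tassoc_bilinear. Qed.

Lemma tassoc_tens3 (m : M) (n : N) (p : P) : tassoc (m ⊗ (n ⊗ p)) = m ⊗ n ⊗ p.
Proof. by rewrite tassoc_tens tmap_tens //; exact: (tens_bilinear M N).2. Qed.

End Associator.

(** * Algebra homomorphisms between tensor products *)

Section TensorAlgebraTheory.
Variables (K : fieldType) (A B : algType K).

Lemma tens_mulE (a a' : A) (b b' : B) : (a ⊗ b) * (a' ⊗ b') = (a * a') ⊗ (b * b').
Proof. exact: tens_mul_tens. Qed.

Lemma tens_1E : (1 : A) ⊗ (1 : B) = 1 :> A ⊗ B.
Proof. by []. Qed.

Lemma mulr_bilinear (C : algType K) : bilinear_map (@GRing.mul C).
Proof.
by split=> [n|m] c x y; [rewrite mulrDl scalerAl | rewrite mulrDr scalerAr].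
Qed.

Lemma linear_mull (C : algType K) (x : C) : linear (fun y => x * y).
Proof. exact: (mulr_bilinear C).2. Qed.

Lemma linear_mulr (C : algType K) (x : C) : linear (fun y => y * x).
Proof. exact: (mulr_bilinear C).1. Qed.

Lemma linearMl (M : lmodType K) (C : algType K) (x : C) (f : M -> C) :
  linear f -> linear (fun t => x * f t).
Proof. exact: linear_comp (linear_mull x). Qed.

Lemma linearMr (M : lmodType K) (C : algType K) (x : C) (f : M -> C) :
  linear f -> linear (fun t => f t * x).
Proof. exact: linear_comp (linear_mulr x). Qed.

End TensorAlgebraTheory.

Section TensorAlgebraMaps.
Variables (K : fieldType) (A B : algType K).

(** An arbitrary bilinear [mul] covers both the product of an algebra and [mulmx], the latter being
    needed for representations. *)
Lemma tensor_mul_ext (W1 W2 W : lmodType K) (mul : W1 -> W2 -> W)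
    (f : A ⊗ B -> W) (f1 : A ⊗ B -> W1) (f2 : A ⊗ B -> W2) :
  bilinear_map mul -> linear f -> linear f1 -> linear f2 ->
  (forall a b a' b', f ((a * a') ⊗ (b * b')) = mul (f1 (a ⊗ b)) (f2 (a' ⊗ b'))) ->
  forall x y, f (x * y) = mul (f1 x) (f2 y).
Proof.
move=> bm lf lf1 lf2 E.
apply: (tensor_linear_ext2 (f := fun x y => f (x * y))
  (g := fun x y => mul (f1 x) (f2 y))).
- by split=> [n|m] c x y; rewrite ?mulrDl ?mulrDr -?scalerAl -?scalerAr lf.
- by split=> [n|m] c x y; rewrite ?lf1 ?lf2 ?bm.1 ?bm.2.
- by move=> *; rewrite tens_mulE E.
Qed.

End TensorAlgebraMaps.

Section TensorHoms.
Variables (K : fieldType) (A B A' B' : algType K).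

(** Three separate maps on each side are required by [tassoc_hom], where they are b ↦ aa' ⊗ b, b ↦ a
    ⊗ b and b ↦ a' ⊗ b: multiplicative jointly, but not one by one. *)
Lemma tmap_mul (f f1 f2 : A -> A') (g g1 g2 : B -> B') :
  linear f -> linear f1 -> linear f2 -> linear g -> linear g1 -> linear g2 ->
  (forall a a', f (a * a') = f1 a * f2 a') ->
  (forall b b', g (b * b') = g1 b * g2 b') ->
  forall x y, tmap f g (x * y) = tmap f1 g1 x * tmap f2 g2 y.
Proof.
move=> lf lf1 lf2 lg lg1 lg2 fM gM.
apply: tensor_mul_ext; try exact: tmap_linear; first exact: mulr_bilinear.
by move=> *; rewrite !tmap_tens // tens_mulE fM gM.
Qed.

Lemma tmap_hom (f : A -> A') (g : B -> B') :
  alg_hom f -> alg_hom g -> alg_hom (tmap f g).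
Proof.
move=> [lf f1 fM] [lg g1 gM]; split; first exact: tmap_linear.
  by rewrite -tens_1E tmap_tens // f1 g1.
by apply: tmap_mul.
Qed.

End TensorHoms.

Section Homs.
Variable K : fieldType.

Lemma hom_id (A : algType K) : alg_hom (@id A).
Proof. by []. Qed.

Lemma hom_comp (A B C : algType K) (f : B -> C) (g : A -> B) :
  alg_hom f -> alg_hom g -> alg_hom (fun x => f (g x)).
Proof.
move=> [lf f1 fM] [lg g1 gM]; split; first exact: linear_comp.
  by rewrite g1 f1.
by move=> x y; rewrite gM fM.
Qed.

Lemma tensl_hom (A B : algType K) : alg_hom (fun a : A => a ⊗ (1 : B)).
Proof.
split=> //; first exact: (tens_bilinear A B).1.
by move=> a b; rewrite tens_mulE mul1r.
Qed.

Lemma tensr_hom (A B : algType K) : alg_hom (fun b : B => (1 : A) ⊗ b).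
Proof.
split=> //; first exact: (tens_bilinear A B).2.
by move=> a b; rewrite tens_mulE mul1r.
Qed.

Lemma tassoc_hom (A B C : algType K) : alg_hom (@tassoc K A B C).
Proof.
have lr (a : A) : linear (fun b : B => a ⊗ b) := (tens_bilinear A B).2 a.
split; first exact: tassoc_linear.
  by rewrite -[1]tens_1E -[X in _ ⊗ X]tens_1E tassoc_tens3.
have la := @tassoc_linear K A B C.
move=> x y; apply: (tensor_mul_ext (mulr_bilinear _) la la la).
move=> a t a' t'; rewrite !tassoc_tens; apply: tmap_mul => // b b'.
by rewrite tens_mulE.
Qed.

Lemma hom_unit (A B : unitAlgType K) (f : A -> B) x :
  alg_hom f -> x \is a GRing.unit -> f x \is a GRing.unit.
Proof.
by move=> [lf f1 fM] ux; apply/unitrP; exists (f x^-1); rewrite -!fM mulVr // mulrV.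
Qed.

Lemma hom_inv (A B : unitAlgType K) (f : A -> B) x :
  alg_hom f -> x \is a GRing.unit -> f x^-1 = (f x)^-1.
Proof.
move=> hf ux; apply: (mulrI (hom_unit hf ux)); rewrite mulrV ?hom_unit //.
by case: hf => [_ f1 fM]; rewrite -fM mulrV.
Qed.

End Homs.

(** * The square of the antipode *)

Section AntipodeSquare.
Variables (K : fieldType) (A : unitAlgType K) (H : qha_data A).
Hypotheses (qH : quasi_hopf H) (tH : quasi_triangular H).

Local Notation Δ := (copr H).
Local Notation ε := (counit H).
Local Notation S := (antip H).
Local Notation α := (qalpha H).
Local Notation β := (qbeta H).

Let lS : linear S. Proof. by case: (antip_antihom qH). Qed.
Let lε : linear ε. Proof. by case: (counit_hom qH). Qed.
Let lΔ : linear Δ. Proof. by case: (copr_hom qH). Qed.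
Let SM a b : S (a * b) = S b * S a. Proof. by case: (antip_antihom qH). Qed.

Lemma antip_alpha_bilinear : bilinear_map (fun x y => S x * α * y).
Proof.
split=> [y|x]; last exact: linear_mull.
exact: (linear_comp (linear_mulr y) (linear_comp (linear_mulr α) lS)).
Qed.

Lemma antip_beta_bilinear : bilinear_map (fun x y => x * β * S y).
Proof.
split=> [y|x]; last exact: (linear_comp (linear_mull (x * β)) lS).
exact: (linear_comp (linear_mulr (S y)) (linear_mulr β)).
Qed.

Lemma antip_alpha_swap_bilinear : bilinear_map (fun a b => S b * α * a).
Proof. by have [l r] := antip_alpha_bilinear; split. Qed.

Definition eval_R : A := tlift (fun a b => S b * α * a) (rmatrix H).

(* The integrand of Drinfeld's element: eval_u Φ = u. Inserting a coproduct on
   either side of the argument yields u a = S^2(a) u by quasi-coassociativity. *)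
Definition eval_u : A ⊗ A ⊗ A -> A :=
  tlift3 (fun x y z => S (y * β * S z) * eval_R * x).

Lemma eval_u_trilinear1 z : bilinear_map (fun x y => S (y * β * S z) * eval_R * x).
Proof.
split=> [y|x]; first exact: linear_mull.
apply: (linear_comp (linear_mulr x)); apply: (linear_comp (linear_mulr _)).
by apply: (linear_comp lS); exact: antip_beta_bilinear.1.
Qed.

Lemma eval_u_trilinear2 x y : linear (fun z => S (y * β * S z) * eval_R * x).
Proof.
apply: (linear_comp (linear_mulr x)); apply: (linear_comp (linear_mulr _)).
by apply: (linear_comp lS); exact: antip_beta_bilinear.2.
Qed.

Lemma eval_u_linear : linear eval_u.
Proof. exact: tlift3_linear eval_u_trilinear1 eval_u_trilinear2. Qed.

Lemma eval_u_tens x y z :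
  eval_u (x ⊗ y ⊗ z) = S (y * β * S z) * eval_R * x.
Proof. exact: tlift3_tens eval_u_trilinear1 eval_u_trilinear2. Qed.

(** Both sides are sums over the same representatives of Φ and R, and the outer factors come out of
    the inner sum over R by distributivity. *)
Lemma drinfeld_uE : drinfeld_u H = eval_u (coassoc H).
Proof.
rewrite /drinfeld_u /eval_u /tlift3 /tlift /fsum_eval.
apply: eq_bigr => p _; apply: eq_bigr => q _ /=.
rewrite mulr_sumr mulr_suml; apply: eq_bigr => r _ /=.
by rewrite !mulrA.
Qed.

Lemma counit_r_bilinear : bilinear_map (fun a b : A => ε b *: a).
Proof.
split=> [b|a] c x y; first by rewrite scalerDr !scalerA mulrC.
by rewrite lε scalerDl -scalerA.
Qed.

Lemma counit_l_bilinear : bilinear_map (fun a b : A => ε a *: b).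
Proof. by have [l r] := counit_r_bilinear; split. Qed.

Lemma copr_l_linear : linear (copr_l H).
Proof. exact: tmap_linear. Qed.

Lemma copr_r_linear : linear (copr_r H).
Proof. exact: (linear_comp (@tassoc_linear _ _ _ _) (tmap_linear _ _)). Qed.

(** For s = p ⊗ q, the coproduct of q lands inside y β S(z) as y q_(1) β S(q_(2)) S(z), which the
    axiom for β collapses to ε(q) y β S(z), while p is left at the far right. *)
Lemma eval_u_copr_r t s : eval_u (t * copr_r H s) = eval_u t * counit_r H s.
Proof.
move: t s; apply: tensor_linear_ext2.
- split=> [s|t].
    exact: (linear_comp eval_u_linear (linear_mulr _)).
  exact: (linear_comp eval_u_linear (linear_comp (linear_mull _) copr_r_linear)).
- split=> [s|t]; first exact: (linear_comp (linear_mulr _) eval_u_linear).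
  exact: (linear_comp (linear_mull _) (tlift_linear counit_r_bilinear)).
move=> xy z p q; move: xy; apply: tlift_unique => [||x y].
- apply: (linear_comp eval_u_linear); apply: (linear_comp (linear_mulr _)).
  exact: (tens_bilinear _ _).1.
- apply: (linear_comp (linear_mulr _)); apply: (linear_comp eval_u_linear).
  exact: (tens_bilinear _ _).1.
(* An arbitrary [t] stands for Δ(q), so that linearity in [t] allows pure tensors. *)
have E (t : A ⊗ A) : eval_u (x ⊗ y ⊗ z * tassoc (p ⊗ t)) =
    S (y * tlift (fun a b => a * β * S b) t * S z) * eval_R * x * p.
  move: t; apply: tlift_unique => [||a b].
  - apply: (linear_comp eval_u_linear); apply: (linear_comp (linear_mull _)).
    exact: (linear_comp (@tassoc_linear _ _ _ _) ((tens_bilinear _ _).2 p)).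
  - do 3!apply: linearMr; apply: (linear_comp lS).
    apply: linearMr; apply: linearMl.
    exact: tlift_linear antip_beta_bilinear.
  rewrite tassoc_tens3 !tens_mulE eval_u_tens tlift_tens;
    last exact: antip_beta_bilinear.
  by rewrite (SM z) !mulrA.
rewrite /copr_r tmap_tens // E (antip_beta qH) eval_u_tens /counit_r tlift_tens;
  last exact: counit_r_bilinear.
by rewrite -scalerAr -scalerAl (linear_scaleE lS) -!scalerAl -!scalerAr.
Qed.

(** The left side is [M] at RΔ(a) = Δ^T(a)R. With Δ^T(a) as the left factor, the innermost
    expression becomes S(a_(1)) α a_(2) = ε(a)α. *)
Lemma eval_R_copr a : tlift (fun x y => S y * eval_R * x) (Δ a) = ε a *: eval_R.
Proof.
pose M := tlift (fun a b => S b * α * a).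
have lM : linear M := tlift_linear antip_alpha_swap_bilinear.
have bR : bilinear_map (fun x y => S y * eval_R * x).
  split=> [y|x]; first exact: linear_mull.
  exact: (linear_comp (linear_mulr x) (linear_comp (linear_mulr _) lS)).
(* As S reverses products, the left factor of a product is evaluated inside the right one. *)
have lt x y : M (x * y) = tlift (fun p q => S q * M x * p) y.
  have bM z : bilinear_map (fun p q => S q * M z * p).
    split=> [q|p]; first exact: linear_mull.
    exact: (linear_comp (linear_mulr p) (linear_comp (linear_mulr _) lS)).
  move: x y; apply: tensor_linear_ext2.
  - split=> [y|x].
      exact: (linear_comp lM (linear_mulr y)).
    exact: (linear_comp lM (linear_mull x)).
  - split=> [y|x]; last exact: tlift_linear.
    apply: (@tlift_linear_param _ _ _ _ _ (fun p q x => S q * M x * p)) => // p q.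
    exact: (linear_comp (linear_mulr p) (linear_comp (linear_mull _) lM)).
  move=> m n p q; rewrite tens_mulE tlift_tens //.
  rewrite /M !tlift_tens; do ?exact: antip_alpha_swap_bilinear.
  by rewrite SM !mulrA.
have -> : tlift (fun x y => S y * eval_R * x) (Δ a) = M (rmatrix H * Δ a) by rewrite lt.
rewrite -(rmatrix_copr tH) lt.
have -> : M (copr_op H a) = ε a *: α.
  rewrite -(antip_alpha qH) /copr_op; move: (Δ a); apply: tlift_unique => [||x y].
  - exact: (linear_comp lM (@tswap_linear _ _ _)).
  - exact: tlift_linear antip_alpha_bilinear.
  rewrite tswap_tens /M !tlift_tens //; first exact: antip_alpha_bilinear.
  exact: antip_alpha_swap_bilinear.
have lZ : linear (fun t : A => ε a *: t).
  by move=> c x y; rewrite scalerDr !scalerA mulrC.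
rewrite /eval_R (tlift_comp lZ antip_alpha_swap_bilinear).
by apply: eq_bigr => p _; rewrite -scalerAr -scalerAl.
Qed.

(** For s = p ⊗ q, the coproduct of p surrounds [eval_R] and is collapsed by [eval_R_copr]; q enters
    under both antipodes and emerges on the left as S^2(q). *)
Lemma eval_u_copr_l s t : eval_u (copr_l H s * t) = S (S (counit_l H s)) * eval_u t.
Proof.
have lSS : linear (fun x => S (S x)) := linear_comp lS lS.
move: s t; apply: tensor_linear_ext2.
- split=> [s|t].
    exact: (linear_comp eval_u_linear (linearMr _ copr_l_linear)).
  exact: (linear_comp eval_u_linear (linear_mull _)).
- split=> [s|t]; last exact: linearMl eval_u_linear.
  apply: linearMr; apply: (linear_comp lSS).
  exact: tlift_linear counit_l_bilinear.
move=> p q xy z; move: xy; apply: tlift_unique => [||x y].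
- apply: (linear_comp eval_u_linear); apply: linearMl.
  exact: (tens_bilinear _ _).1.
- apply: linearMl; apply: (linear_comp eval_u_linear).
  exact: (tens_bilinear _ _).1.
have bR : bilinear_map (fun x y => S y * eval_R * x).
  split=> [b|b]; first exact: linear_mull.
  exact: (linearMr _ (linearMr _ lS)).
have E (t : A ⊗ A) : eval_u (t ⊗ q * (x ⊗ y ⊗ z)) =
    S (S q) * S (y * β * S z) * tlift (fun x y => S y * eval_R * x) t * x.
  move: t; apply: tlift_unique => [||a b].
  - apply: (linear_comp eval_u_linear); apply: linearMr.
    exact: (tens_bilinear _ _).1.
  - apply: linearMr; apply: linearMl; exact: tlift_linear.
  rewrite !tens_mulE eval_u_tens tlift_tens //.
  by rewrite -!mulrA !SM !mulrA.
rewrite /copr_l tmap_tens // E eval_R_copr eval_u_tens /counit_l tlift_tens;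
  last exact: counit_l_bilinear.
by rewrite (linear_scaleE lSS) -scalerAr -!scalerAl !mulrA.
Qed.

Lemma antip_antip_u a : S (S a) * drinfeld_u H = drinfeld_u H * a.
Proof.
(* On the left [a] is written as (ε ⊗ 1)Δ(a), on the right as (1 ⊗ ε)Δ(a). The two sides become
   [eval_u] of (Δ ⊗ 1)Δ(a)Φ and of Φ(1 ⊗ Δ)Δ(a), which quasi-coassociativity identifies. *)
rewrite drinfeld_uE -{1}(counit_copr_l qH a) -eval_u_copr_l.
rewrite -{2}(counit_copr_r qH a) -eval_u_copr_r (quasi_coassoc qH) !mulrA.
by rewrite mulrV ?mul1r // (coassoc_unit qH).
Qed.

End AntipodeSquare.

(** * Cancellation of the twist under a cyclic linear form *)

Section TwistedTrace.
Variables (K : fieldType) (A : unitAlgType K) (H : qha_data A).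
Hypothesis qH : quasi_hopf H.
Variables (chi : A -> K^o) (g : A).
Hypotheses (lchi : linear chi) (chiC : forall a b, chi (a * b) = chi (b * a)).
Hypothesis Sg : forall a, antip H (antip H a) * g = g * a.

Local Notation S := (antip H).
Local Notation α := (qalpha H).
Local Notation β := (qbeta H).

Lemma trace_twist_beta_alpha (F : A ⊗ A) : F \is a GRing.unit ->
  chi (qbeta (twist H F) * S (qalpha (twist H F)) * g) = chi (β * S α * g).
Proof.
move=> uF; case: (antip_antihom qH) => lS S1 SM.
have bA := antip_alpha_bilinear qH; have bB := antip_beta_bilinear qH.
(* With [x] and [y] independent the claim is bilinear. For y = c ⊗ d, S(S(c)αd) ends in S^2(c); [Sg]
   moves c to the right of [g] and [chiC] brings it to the front. The product is y x, so x = F and y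
   = F^-1 give 1. *)
have E (x y : A ⊗ A) :
    chi (tlift (fun a b => a * β * S b) x
          * S (tlift (fun a b => S a * α * b) y) * g)
    = chi (tlift (fun a b => a * β * S b) (y * x) * S α * g).
  move: x y; apply: tensor_linear_ext2.
  - split=> [y|x]; apply: (linear_comp lchi); apply: linearMr.
      by apply: linearMr; apply: tlift_linear.
    by apply: linearMl; apply: (linear_comp lS); apply: tlift_linear.
  - split=> [y|x]; apply: (linear_comp lchi); do 2!apply: linearMr.
      exact: (linear_comp (tlift_linear bB) (linear_mull _)).
    exact: (linear_comp (tlift_linear bB) (linear_mulr _)).
  move=> a b c d; rewrite tens_mulE !tlift_tens // !SM -!mulrA Sg !mulrA.
  by rewrite [LHS]chiC !mulrA.
rewrite /= E mulVr // -tens_1E tlift_tens // S1 mul1r mulr1 //.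
Qed.

End TwistedTrace.

(** * Operators on tensor powers *)

Section TensorOperators.
Variables (K : fieldType) (d : nat).

Lemma tensmx_bilinear (m n p q : nat) :
  bilinear_map (fun (X : 'M[K]_(m, n)) (Y : 'M[K]_(p, q)) => X *t Y).
Proof.
split=> [Y|X] c U V; apply/matrixP=> i j; rewrite !mxE.
  by rewrite mulrDl mulrA.
by rewrite mulrDr mulrCA.
Qed.

Lemma mulmx_bilinear (m n p : nat) :
  bilinear_map (fun (X : 'M[K]_(m, n)) (Y : 'M[K]_(n, p)) => X *m Y).
Proof.
split=> [Y|X] c U V; first by rewrite mulmxDl -scalemxAl.
by rewrite mulmxDr -scalemxAr.
Qed.

Lemma tensmx1 (m n : nat) : (1%:M : 'M[K]_m) *t (1%:M : 'M[K]_n) = 1%:M.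
Proof.
apply/matrixP=> i j; case: (mxtens_indexP i) => i1 i2.
case: (mxtens_indexP j) => j1 j2; rewrite tensmxE !mxE -natrM mulnb.
by rewrite (can_eq (@mxtens_indexK _ _)).
Qed.

Lemma castmx_mulmx m n (e : m = n) (X Y : 'M[K]_m) :
  castmx (e, e) X *m castmx (e, e) Y = castmx (e, e) (X *m Y).
Proof. by case: _ / e. Qed.

(** The cast, the same as in [last_two], is forced by [tdim] nesting to the left:
    [tdim d n * (d * d)] must be read as [tdim d n * d * d]. *)
Definition last_site (n : nat) (X : 'M[K]_(tdim d n)) (Y : 'M[K]_(d * d)) :
    'M[K]_(tdim d n.+2) :=
  castmx (mulnA _ _ _, mulnA _ _ _) (X *t Y).

Lemma last_twoS (X : 'M[K]_(d * d)) n : last_two X n.+1 = last_site 1%:M X.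
Proof. by []. Qed.

Lemma last_site_mul n (X X' : 'M[K]_(tdim d n)) Y Y' :
  last_site X Y *m last_site X' Y' = last_site (X *m X') (Y *m Y').
Proof.
by rewrite /last_site -tensmx_mul castmx_mulmx.
Qed.

(** Pairs of indices are numbered lexicographically, so both groupings of a triple (a, b, c) give
    the number a d^2 + b d + c. *)
Lemma last_site_tens n (X : 'M[K]_(tdim d n)) (Y Z : 'M[K]_d) :
  last_site X (Y *t Z) = X *t Y *t Z.
Proof.
apply/matrixP=> i j; rewrite castmxE.
case: (mxtens_indexP i) => i' i3; case: (mxtens_indexP i') => i1 i2.
case: (mxtens_indexP j) => j' j3; case: (mxtens_indexP j') => j1 j2.
have E (a : 'I_(tdim d n)) (b c : 'I_d) :
    cast_ord (esym (mulnA (tdim d n) d d)) (mxtens_index (mxtens_index (a, b), c))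
    = mxtens_index (a, mxtens_index (b, c)).
  by apply: val_inj; rewrite /= mulnDl mulnA addnA.
by rewrite !E !tensmxE mulrA.
Qed.

Lemma last_site_linear n (X : 'M[K]_(tdim d n)) : linear (last_site X).
Proof.
move=> c U V; rewrite /last_site (tensmx_bilinear _ _ _ _).2.
by apply/matrixP=> i j; rewrite !(castmxE, mxE).
Qed.

Lemma flip_mx_tens (X Y : 'M[K]_d) :
  flip_mx K d *m (X *t Y) = (Y *t X) *m flip_mx K d.
Proof.
have E (Z : 'M[K]_d) i j : delta_mx i j *m Z = \sum_k Z j k *: delta_mx i k.
  apply/matrixP=> r s; rewrite summxE !mxE (bigD1 j) //= big1 => [|k nkj].
    rewrite mxE eqxx andbT addr0 (bigD1 s) //= big1 => [|k nks].
      by rewrite !mxE eqxx andbT addr0 mulrC.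
    by rewrite !mxE (eq_sym s) (negPf nks) andbF mulr0.
  by rewrite mxE (negPf nkj) andbF mul0r.
have E' (Z : 'M[K]_d) i j : Z *m delta_mx i j = \sum_k Z k i *: delta_mx k j.
  apply: trmx_inj; rewrite trmx_mul trmx_delta E linear_sum /=.
  by apply: eq_bigr => k _; rewrite linearZ /= trmx_delta mxE.
have bt := @tensmx_bilinear d d d d.
(* The matrix unit has row pair (i, j) and column pair (k, l). Expanding the left product sums over
   rows outside and columns inside, the right one over columns (in reverse order) outside and rows
   inside; the rest is a reordering of this fourfold sum. *)
pose T i j k l := (X j k * Y i l) *: (delta_mx i k *t (delta_mx j l : 'M[K]_d)).
have L i j : delta_mx i j *t delta_mx j i *m (X *t Y) = \sum_k \sum_l T i j k l.
  rewrite tensmx_mul !E.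
  rewrite (big_morph (fun Z => Z *t _) (linear_addE (bt.1 _)) (linear_at0 (bt.1 _))).
  apply: eq_bigr => k _.
  rewrite (big_morph (fun Z => _ *t Z) (linear_addE (bt.2 _)) (linear_at0 (bt.2 _))).
  apply: eq_bigr => l _.
  by rewrite (linear_scaleE (bt.1 _)) (linear_scaleE (bt.2 _)) scalerA.
have R i j : Y *t X *m (delta_mx i j *t delta_mx j i) = \sum_k \sum_l T k l j i.
  rewrite tensmx_mul !E'.
  rewrite (big_morph (fun Z => Z *t _) (linear_addE (bt.1 _)) (linear_at0 (bt.1 _))).
  apply: eq_bigr => k _.
  rewrite (big_morph (fun Z => _ *t Z) (linear_addE (bt.2 _)) (linear_at0 (bt.2 _))).
  apply: eq_bigr => l _.
  rewrite (linear_scaleE (bt.1 _)) (linear_scaleE (bt.2 _)) scalerA.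
  by rewrite /T mulrC.
rewrite /flip_mx mulmx_suml mulmx_sumr.
under eq_bigr => i _ do rewrite mulmx_suml.
under [RHS]eq_bigr => i _ do rewrite mulmx_sumr.
under eq_bigr => i _ do under eq_bigr => j _ do rewrite L.
under [RHS]eq_bigr => i _ do under eq_bigr => j _ do rewrite R.
rewrite [LHS]pair_big [RHS]pair_big /=.
under [RHS]eq_bigr => p _ do rewrite pair_big /=.
rewrite [RHS]exchange_big /=; apply: eq_bigr => q _.
by rewrite -(pair_big xpredT xpredT (fun i j => T q.1 q.2 j i)) exchange_big.
Qed.

End TensorOperators.

Section TensorPowerRep.
Variables (K : fieldType) (A : unitAlgType K) (d : nat) (pi : A -> 'M[K]_d).
Hypotheses (lpi : linear pi) (pi1 : pi 1 = 1%:M).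
Hypothesis piM : forall a b, pi (a * b) = pi a *m pi b.

Lemma tpow_rep_linear n : linear (@tpow_rep K A d pi n).
Proof.
elim: n => [//|n IHn]; apply: tlift_linear; split=> [a|x].
  exact: (linear_comp ((tensmx_bilinear _ _ _ _ _).1 _) IHn).
exact: (linear_comp ((tensmx_bilinear _ _ _ _ _).2 _) lpi).
Qed.

Lemma tpow_rep_tens n (x : tpow A n) (a : A) :
  @tpow_rep K A d pi n.+1 (x ⊗ a) = tpow_rep pi x *t pi a.
Proof.
rewrite /= tlift_tens //; split=> [b|y].
  exact: (linear_comp ((tensmx_bilinear _ _ _ _ _).1 _) (@tpow_rep_linear n)).
exact: (linear_comp ((tensmx_bilinear _ _ _ _ _).2 _) lpi).
Qed.

Lemma tpow_rep1 n : tpow_rep pi (1 : tpow A n) = 1%:M.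
Proof.
elim: n => [//|n IHn]; rewrite -[X in tpow_rep _ X](tens_1E (tpow A n) A).
by rewrite tpow_rep_tens IHn pi1 tensmx1.
Qed.

Lemma tpow_rep_mul n (x y : tpow A n) :
  tpow_rep pi (x * y) = tpow_rep pi x *m tpow_rep pi y.
Proof.
elim: n x y => [//|n IHn] x y.
have l := @tpow_rep_linear n.+1.
apply: (tensor_mul_ext (mulmx_bilinear _ _ _ _) l l l) => a b a' b'.
by rewrite !tpow_rep_tens tensmx_mul IHn piM.
Qed.

(** [tassoc] regroups tensors exactly as the cast in [last_site] regroups matrix indices, so
    elements placed on the last two factors can be compared with [last_two]. *)
Lemma tpow_rep_tassoc n (x : tpow A n) (t : A ⊗ A) :
  @tpow_rep K A d pi n.+2 (tassoc (x ⊗ t))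
  = last_site (tpow_rep pi x) (@tpow_rep K A d pi 1 t).
Proof.
move: t; apply: tlift_unique => [||a b].
- apply: (linear_comp (@tpow_rep_linear n.+2)).
  exact: (linear_comp (@tassoc_linear _ _ _ _) ((tens_bilinear _ _).2 x)).
- exact: (linear_comp (@last_site_linear _ _ _ _) (@tpow_rep_linear 1)).
by rewrite tassoc_tens3 (tpow_rep_tens (n := 0)) last_site_tens !tpow_rep_tens.
Qed.

Lemma tpow_rep_tswap (t : A ⊗ A) :
  flip_mx K d *m @tpow_rep K A d pi 1 t
  = @tpow_rep K A d pi 1 (tswap t) *m flip_mx K d.
Proof.
have l1 := @tpow_rep_linear 1.
move: t; apply: tlift_unique => [||a b].
- exact: (linear_comp ((mulmx_bilinear _ _ _ _).2 _) l1).
- apply: (linear_comp ((mulmx_bilinear _ _ _ _).1 _)).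
  exact: (linear_comp l1 (@tswap_linear _ _ _)).
by rewrite tswap_tens !(tpow_rep_tens (n := 0)) flip_mx_tens.
Qed.

End TensorPowerRep.

(** * Iterated coproducts and twisting *)

Section IteratedCoproduct.
Variables (K : fieldType) (A : unitAlgType K) (H : qha_data A).
Hypothesis hΔ : alg_hom (copr H).

Lemma copr_head_hom n : alg_hom (@copr_head K A H n).
Proof. by elim: n => [//|n IHn]; apply: tmap_hom. Qed.

Lemma copr_iter_hom n : alg_hom (@copr_iter K A H n).
Proof. by elim: n => [//|n IHn]; apply: hom_comp IHn; apply: copr_head_hom. Qed.

(** The definition splits the leftmost factor as its last operation. Peeling off the first coproduct
    instead exposes Δ(a), to which the twist and quasi-coassociativity apply. *)
Lemma copr_iterS n a :
  @copr_iter K A H n.+1 a = tmap (@copr_iter K A H n) id (copr H a).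
Proof.
elim: n => [|n IHn]; first by rewrite tmap_id.
have [lD _ _] := copr_iter_hom n; have [lh _ _] := copr_head_hom n.
by rewrite -[LHS]/(copr_head H (copr_iter H n.+1 a)) IHn /= tmap_comp.
Qed.

Fixpoint twist_iter (F : A ⊗ A) (n : nat) : tpow A n :=
  if n is m.+1 then
    (twist_iter F m ⊗ (1 : A)) * tmap (@copr_iter K A H m) id F
  else 1.

Lemma twist_copr_hom (F : A ⊗ A) : F \is a GRing.unit -> alg_hom (copr (twist H F)).
Proof.
case: hΔ => lD D1 DM uF; split=> [||a b] /=.
- exact: (linearMr _ (linearMl _ lD)).
- by rewrite D1 mulr1 mulrV.
- by rewrite DM !mulrA mulrVK.
Qed.

End IteratedCoproduct.

Lemma tmap_conj (K : fieldType) (A : algType K) (B C E : unitAlgType K)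
    (f : B -> C) (h : E -> A) (g : C) t :
  linear f -> linear h -> g \is a GRing.unit ->
  tmap (fun b => g * f b * g^-1) h t
  = (g ⊗ (1 : A)) * tmap f h t * (g ⊗ (1 : A))^-1.
Proof.
move=> lf lh ug; have lc : linear (fun b => g * f b * g^-1).
  exact: (linearMr _ (linearMl _ lf)).
move: t; apply: tlift_unique => [||b e]; first exact: tmap_linear.
  exact: (linearMr _ (linearMl _ (tmap_linear lf lh))).
rewrite !tmap_tens // -(hom_inv (tensl_hom C A)) //.
by rewrite !tens_mulE mul1r mulr1.
Qed.

Section TwistIter.
Variables (K : fieldType) (A : unitAlgType K) (H : qha_data A).
Hypothesis hΔ : alg_hom (copr H).
Variable F : A ⊗ A.
Hypothesis uF : F \is a GRing.unit.

Local Notation G := (twist_iter H F).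
Local Notation D := (@copr_iter K A H).
Local Notation DF := (@copr_iter K A (twist H F)).

Lemma twist_iter_unit n : G n \is a GRing.unit.
Proof.
elim: n => [|n IHn]; first exact: unitr1.
have hD := tmap_hom (copr_iter_hom hΔ n) (hom_id A).
by rewrite /= unitrMl ?(hom_unit hD) // (hom_unit (tensl_hom _ _)).
Qed.

(** In the inductive step Δ_F^(n) ⊗ 1, which is Δ^(n) ⊗ 1 conjugated by G_n ⊗ 1, is applied to
    FΔ(a)F^-1; multiplicativity of Δ^(n) ⊗ 1 splits off the remaining factor of G_(n+1). *)
Lemma twist_copr_iter n a : DF n a = G n * D n a * (G n)^-1.
Proof.
elim: n a => [|n IHn] a; first by rewrite mul1r invr1 mulr1.
have [lD _ _] := copr_iter_hom hΔ n.
have hD := tmap_hom (copr_iter_hom hΔ n) (hom_id A); have [_ _ DM] := hD.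
rewrite !copr_iterS //; last exact: twist_copr_hom.
rewrite (tmap_eq _ IHn (frefl _)) tmap_conj //; last exact: twist_iter_unit.
rewrite /= !DM (hom_inv hD uF) invrM ?(hom_unit hD) //; first by rewrite !mulrA.
by rewrite (hom_unit (tensl_hom _ _)) // twist_iter_unit.
Qed.

End TwistIter.

(** * Braid operators *)

Section BraidGenerators.
Variables (K : fieldType) (A : unitAlgType K) (H : qha_data A).
Hypothesis hΔ : alg_hom (copr H).
Hypothesis uΦ : coassoc H \is a GRing.unit.

Local Notation D := (@copr_iter K A H).

(** At Φ this is [coassoc_iter H n.+2] by conversion. The lemmas that follow evaluate it on each
    kind of factor occurring in Φ_F. *)
Definition copr_iter3 n : A ⊗ A ⊗ A -> tpow A n.+2 := tmap (tmap (D n) id) id.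

Lemma copr_iter3_hom n : alg_hom (@copr_iter3 n).
Proof. by do 2!apply: tmap_hom => //; exact: copr_iter_hom. Qed.

Let lD n : linear (D n). Proof. by case: (copr_iter_hom hΔ n). Qed.
Let lDi n : linear (tmap (D n) (@id A)).
Proof. exact: (tmap_linear (@lD n) (@linear_id _ _)). Qed.
Let lΔ : linear (copr H). Proof. by case: hΔ. Qed.
Let lJ n : linear (@copr_iter3 n). Proof. by case: (copr_iter3_hom n). Qed.

Lemma copr_l_hom : alg_hom (copr_l H).
Proof. exact: tmap_hom. Qed.

Lemma copr_r_hom : alg_hom (copr_r H).
Proof. by apply: hom_comp (tassoc_hom _ _ _) _; apply: tmap_hom. Qed.

Lemma tens23_hom : alg_hom (@tens23 K A).
Proof. by apply: tmap_hom => //; apply: tensr_hom. Qed.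

Lemma copr_iter3_tens12 n t : copr_iter3 n (tens12 t) = tmap (D n) id t ⊗ 1.
Proof. by rewrite /copr_iter3 tmap_tens //; exact: lDi. Qed.

Lemma copr_iter3_copr_l n t : copr_iter3 n (copr_l H t) = tmap (D n.+1) id t.
Proof.
rewrite /copr_iter3 /copr_l tmap_comp //; last exact: lDi.
by apply: tmap_eq => // a; rewrite -copr_iterS.
Qed.

Lemma copr_iter3_tassoc n a t :
  copr_iter3 n (tassoc (a ⊗ t)) = tassoc (D n a ⊗ t).
Proof.
move: t; apply: tlift_unique => [||b c].
- apply: (linear_comp (@lJ n)).
  exact: (linear_comp (@tassoc_linear _ _ _ _) ((tens_bilinear _ _).2 a)).
- exact: (linear_comp (@tassoc_linear _ _ _ _) ((tens_bilinear _ _).2 _)).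
by rewrite !tassoc_tens3 /copr_iter3 !tmap_tens //; [exact: lD | exact: lDi].
Qed.

Lemma copr_iter3_copr_r n t :
  copr_iter3 n (copr_r H t) = tassoc (tmap (D n) (copr H) t).
Proof.
move: t; apply: tlift_unique => [||b c].
- by case: (hom_comp (copr_iter3_hom n) copr_r_hom).
- exact: (linear_comp (@tassoc_linear _ _ _ _) (tmap_linear (@lD n) lΔ)).
rewrite /copr_r (tmap_tens _ _ (@linear_id _ _) lΔ) copr_iter3_tassoc.
by rewrite (tmap_tens _ _ (@lD n) lΔ).
Qed.

Lemma copr_iter3_tens23 n t : copr_iter3 n (tens23 t) = tassoc (1 ⊗ t).
Proof.
move: t; apply: tlift_unique => [||b c].
- by case: (hom_comp (copr_iter3_hom n) tens23_hom).
- exact: (linear_comp (@tassoc_linear _ _ _ _) ((tens_bilinear _ _).2 _)).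
rewrite /tens23 tmap_tens //; last exact: (tens_bilinear _ _).2.
rewrite -tassoc_tens3 copr_iter3_tassoc.
by case: (copr_iter_hom hΔ n) => _ -> _.
Qed.

Lemma coassoc_iter_unit i : coassoc_iter H i \is a GRing.unit.
Proof.
case: i => [|[|k]]; try exact: unitr1.
exact: (hom_unit (copr_iter3_hom k) uΦ).
Qed.

Lemma coassoc_at_unit n i : coassoc_at H n i \is a GRing.unit.
Proof.
elim: n => [|n IHn]; first exact: unitr1.
rewrite /=; case: eqP => _; first exact: (coassoc_iter_unit n.+1).
exact: (hom_unit (tensl_hom _ _)).
Qed.

Variables (d : nat) (pi : A -> 'M[K]_d).
Hypotheses (lpi : linear pi) (pi1 : pi 1 = 1%:M).
Hypothesis piM : forall a b, pi (a * b) = pi a *m pi b.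

Local Notation ρ := (tpow_rep pi).

Lemma tpow_rep_mulV n (x : tpow A n) :
  x \is a GRing.unit -> ρ x *m ρ x^-1 = 1%:M.
Proof. by move=> ux; rewrite -tpow_rep_mul // mulrV // tpow_rep1. Qed.

Lemma tpow_rep_mulVl n (x : tpow A n) :
  x \is a GRing.unit -> ρ x^-1 *m ρ x = 1%:M.
Proof. by move=> ux; rewrite -tpow_rep_mul // mulVr // tpow_rep1. Qed.

Lemma braid_gen_widen m i : (i <= m)%N ->
  braid_gen pi H m.+1 i = braid_gen pi H m i *t 1%:M.
Proof.
move=> im; have ni : (i == m.+1) = false by apply/eqP => ei; rewrite ei ltnn in im.
have Ec : coassoc_at H m.+1 i = coassoc_at H m i ⊗ 1 by rewrite /= ni.
have Et X : @two_site K d X m.+1 i = two_site X m i *t 1%:M by rewrite /= ni.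
rewrite /braid_gen Ec Et -(hom_inv (tensl_hom _ _) (coassoc_at_unit m i)).
by rewrite !(tpow_rep_tens lpi) !tensmx_mul pi1 !mul1mx.
Qed.

Lemma braid_gen_last n :
  braid_gen pi H n.+1 n.+1
  = ρ (coassoc_iter H n.+1) *m last_two (rcheck pi H) n
      *m ρ (coassoc_iter H n.+1)^-1.
Proof. by rewrite /braid_gen /= eqxx. Qed.

Hypothesis Rcopr : forall a, copr_op H a * rmatrix H = rmatrix H * copr H a.

(** R turns Δ into Δ^T and the flip turns it back. *)
Lemma rcheck_comm a :
  rcheck pi H *m @tpow_rep K A d pi 1 (copr H a)
  = @tpow_rep K A d pi 1 (copr H a) *m rcheck pi H.
Proof.
have M (x y : A ⊗ A) := @tpow_rep_mul K A d pi lpi piM 1 x y.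
rewrite /rcheck -mulmxA -(M (rmatrix H) (copr H a)) -Rcopr M !mulmxA.
by rewrite tpow_rep_tswap // /copr_op tswapK.
Qed.

End BraidGenerators.

(* Non-invertible matrices are allowed: there invmx is the identity. *)
Lemma invmx_intertwine (K : fieldType) n (s t g : 'M[K]_n) :
  (s \in unitmx) = (t \in unitmx) -> s *m g = g *m t ->
  invmx s *m g = g *m invmx t.
Proof.
move=> st sg; have [us|nus] := boolP (s \in unitmx); last first.
  by have nut := nus; rewrite st in nut; rewrite !invmx_out.
have ut : t \in unitmx by rewrite -st.
apply: (can_inj (mulKmx us)); rewrite mulKVmx //.
by rewrite mulmxA sg -mulmxA mulmxV // mulmx1.
Qed.

(** * Braid words commute with iterated coproducts *)

Section BraidCommutation.
Variables (K : fieldType) (A : unitAlgType K) (H : qha_data A).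
Hypotheses (qH : quasi_hopf H) (tH : quasi_triangular H).
Variables (d : nat) (pi : A -> 'M[K]_d).
Hypotheses (lpi : linear pi) (pi1 : pi 1 = 1%:M).
Hypothesis piM : forall a b, pi (a * b) = pi a *m pi b.

Local Notation D := (@copr_iter K A H).
Local Notation ρ := (tpow_rep pi).
Let hΔ : alg_hom (copr H) := copr_hom qH.
Let uΦ : coassoc H \is a GRing.unit := coassoc_unit qH.
Let lD n : linear (D n). Proof. by case: (copr_iter_hom hΔ n). Qed.
Let lΔ : linear (copr H). Proof. by case: hΔ. Qed.

(** On pure tensors the last two factors carry a coproduct, so this reduces to [rcheck_comm]. *)
Lemma last_two_rcheck_comm n (t : A ⊗ A) :
  last_two (rcheck pi H) n.+1
    *m @tpow_rep _ _ _ pi n.+2 (tassoc (tmap (D n) (copr H) t))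
  = @tpow_rep _ _ _ pi n.+2 (tassoc (tmap (D n) (copr H) t))
    *m last_two (rcheck pi H) n.+1.
Proof.
have l : linear (fun t => @tpow_rep _ _ _ pi n.+2 (tassoc (tmap (D n) (copr H) t))).
  apply: (linear_comp (tpow_rep_linear lpi (n := n.+2))).
  exact: (linear_comp (@tassoc_linear _ _ _ _) (tmap_linear (@lD n) lΔ)).
move: t; apply: tlift_unique => [||a b].
- exact: (linear_comp ((mulmx_bilinear _ _ _ _).2 _) l).
- exact: (linear_comp ((mulmx_bilinear _ _ _ _).1 _) l).
rewrite (tmap_tens _ _ (@lD n) lΔ) tpow_rep_tassoc // last_twoS !last_site_mul.
by rewrite mul1mx mulmx1 (rcheck_comm lpi piM (rmatrix_copr tH)).
Qed.

Lemma braid_gen_last_comm n a :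
  braid_gen pi H n.+1 n.+1 *m ρ (D n.+1 a)
  = ρ (D n.+1 a) *m braid_gen pi H n.+1 n.+1.
Proof.
rewrite braid_gen_last; case: n => [|n].
  rewrite /= invr1 -[tlift _ 1]/(ρ (1 : tpow A 1)) tpow_rep1 // !(mul1mx, mulmx1).
  exact: (rcheck_comm lpi piM (rmatrix_copr tH)).
have uJ : coassoc_iter H n.+2 \is a GRing.unit := coassoc_iter_unit hΔ uΦ n.+2.
have [lJ J1 JM] := copr_iter3_hom hΔ n.
(* Quasi-coassociativity pushed through Δ^(n) ⊗ 1 ⊗ 1: it trades Δ^(n+2)(a) for (Δ^(n) ⊗ Δ)Δ(a),
   whose last two factors are a coproduct. *)
have E : (coassoc_iter H n.+2)^-1 * D n.+2 a
    = tassoc (tmap (D n) (copr H) (copr H a)) * (coassoc_iter H n.+2)^-1.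
  rewrite copr_iterS // -copr_iter3_copr_l // -copr_iter3_copr_r //.
  rewrite (quasi_coassoc qH) -/(copr_iter3 H n (coassoc H)) !JM.
  by rewrite (hom_inv (copr_iter3_hom hΔ n) uΦ) mulrK.
have M (x y : tpow A n.+2) := tpow_rep_mul lpi piM x y.
rewrite -mulmxA -M E M !mulmxA -(mulmxA (ρ (coassoc_iter H n.+2))).
rewrite last_two_rcheck_comm !mulmxA -M.
have -> : coassoc_iter H n.+2 * tassoc (tmap (D n) (copr H) (copr H a))
    = D n.+2 a * coassoc_iter H n.+2.
  by apply: (canRL (mulrVK uJ)); rewrite -mulrA -E mulrA mulrV ?mul1r.
by rewrite M.
Qed.

(** An arbitrary [t] serves two purposes: t = Δ(a) gives commutation with the next iterated
    coproduct, t = F gives the passage through the new factor of G_(n+1). *)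
Lemma tens1_rep_comm n (s : 'M[K]_(tdim d n)) t :
  (forall b, s *m ρ (D n b) = ρ (D n b) *m s) ->
  (s *t (1%:M : 'M[K]_d)) *m @tpow_rep _ _ _ pi n.+1 (tmap (D n) id t)
  = @tpow_rep _ _ _ pi n.+1 (tmap (D n) id t) *m (s *t (1%:M : 'M[K]_d)).
Proof.
move=> sD.
have l : linear (fun t => @tpow_rep _ _ _ pi n.+1 (tmap (D n) id t)).
  apply: (linear_comp (tpow_rep_linear lpi (n := n.+1))).
  exact: (tmap_linear (@lD n) (@linear_id _ _)).
move: t; apply: tlift_unique => [||b c].
- exact: (linear_comp ((mulmx_bilinear _ _ _ _).2 _) l).
- exact: (linear_comp ((mulmx_bilinear _ _ _ _).1 _) l).
rewrite (tmap_tens _ _ (@lD n) (@linear_id _ _)) tpow_rep_tens //.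
by rewrite !tensmx_mul sD mul1mx mulmx1.
Qed.

Lemma braid_gen_comm n i a : (0 < i <= n)%N ->
  braid_gen pi H n i *m ρ (D n a) = ρ (D n a) *m braid_gen pi H n i.
Proof.
elim: n i a => [|n IHn] i a; first by case: i.
case/andP=> i0; rewrite leq_eqVlt ltnS => /predU1P[->|lin].
  exact: braid_gen_last_comm.
rewrite braid_gen_widen // copr_iterS //; apply: tens1_rep_comm => b.
by apply: IHn; rewrite i0.
Qed.

Lemma word_op_comm n (w : braid_word n) a :
  word_op pi H w *m ρ (D n a) = ρ (D n a) *m word_op pi H w.
Proof.
rewrite /word_op; elim: w => [|[i b] w IHw]; first by rewrite big_nil mul1mx mulmx1.
rewrite big_cons /= -mulmxA IHw !mulmxA; congr (_ *m _).
have C : braid_gen pi H n i.+1 *m ρ (D n a) = ρ (D n a) *m braid_gen pi H n i.+1.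
  by apply: braid_gen_comm; rewrite /= ltn_ord.
by case: b => //; apply: invmx_intertwine.
Qed.

End BraidCommutation.

(** * The iterated twist intertwines the two braid actions *)

Section TwistIntertwiner.
Variables (K : fieldType) (A : unitAlgType K) (H : qha_data A).
Hypotheses (qH : quasi_hopf H) (tH : quasi_triangular H).
Variable F : A ⊗ A.
Hypothesis uF : F \is a GRing.unit.
Variables (d : nat) (pi : A -> 'M[K]_d).
Hypotheses (lpi : linear pi) (pi1 : pi 1 = 1%:M).
Hypothesis piM : forall a b, pi (a * b) = pi a *m pi b.

Local Notation HF := (twist H F).
Local Notation G := (twist_iter H F).
Local Notation D := (@copr_iter K A H).
Local Notation DF := (@copr_iter K A HF).
Local Notation ρ := (tpow_rep pi).
Let hΔ : alg_hom (copr H) := copr_hom qH.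
Let hΔF : alg_hom (copr HF) := twist_copr_hom hΔ uF.
Let uΦ : coassoc H \is a GRing.unit := coassoc_unit qH.
Let lD n : linear (D n). Proof. by case: (copr_iter_hom hΔ n). Qed.
Let lDi n : linear (tmap (D n) (@id A)).
Proof. exact: (tmap_linear (@lD n) (@linear_id _ _)). Qed.
Let uG n : G n \is a GRing.unit := twist_iter_unit hΔ uF n.
Let uG1 n : (G n ⊗ 1 : tpow A n.+1) \is a GRing.unit.
Proof. exact: (hom_unit (tensl_hom (tpow A n) A) (uG n)). Qed.
Let uG2 n : (G n ⊗ 1 ⊗ 1 : tpow A n.+2) \is a GRing.unit.
Proof. exact: (hom_unit (tensl_hom (tpow A n.+1) A) (uG1 n)). Qed.

Lemma coassoc_twist_unit : coassoc HF \is a GRing.unit.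
Proof.
have u12 := hom_unit (tensl_hom _ A) uF.
have ul := hom_unit (copr_l_hom hΔ) uF.
have ur : copr_r H F^-1 \is a GRing.unit.
  by apply: hom_unit (copr_r_hom hΔ) _; rewrite unitrV.
have u23 := hom_unit (@tens23_hom K A) uF.
by rewrite /= unitrMr ?unitrV // unitrMr // unitrMr // unitrMr.
Qed.

(** R_F F = F_21 R, and the flip moves F_21 out to its left as F. *)
Lemma rcheck_twist :
  rcheck pi HF *m @tpow_rep K A d pi 1 F = @tpow_rep K A d pi 1 F *m rcheck pi H.
Proof.
have M (x y : A ⊗ A) := @tpow_rep_mul K A d pi lpi piM 1 x y.
have E : rmatrix HF * F = tswap F * rmatrix H by rewrite /= mulrVK.
rewrite /rcheck -mulmxA -(M (rmatrix HF) F) E M mulmxA.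
by rewrite tpow_rep_tswap // tswapK mulmxA.
Qed.

Lemma copr_iter3_twist n t : copr_iter3 HF n t
  = (G n ⊗ (1 : A) ⊗ (1 : A)) * copr_iter3 H n t * (G n ⊗ (1 : A) ⊗ (1 : A))^-1.
Proof.
rewrite /copr_iter3.
pose f y := (G n ⊗ (1 : A)) * tmap (D n) id y * (G n ⊗ (1 : A))^-1.
rewrite (tmap_eq (f' := f) (g' := id)) //.
  exact: (tmap_conj t (@lDi n) (@linear_id _ _) (uG1 n)).
move=> y; rewrite /f -(tmap_conj y (@lD n) (@linear_id _ _) (uG n)).
apply: tmap_eq => // a.
exact: twist_copr_iter.
Qed.

(* Φ_F,i = G_i Φ_i W^-1 with W = twist_tail, and W turns the twisted R-matrix
   acting on the last two factors into the untwisted one. *)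
Definition twist_tail n : tpow A n.+2 :=
  (G n ⊗ (1 : A) ⊗ (1 : A)) * tassoc (1 ⊗ F) * tassoc (tmap (D n) (copr H) F).

Lemma twist_tail_unit n : twist_tail n \is a GRing.unit.
Proof.
rewrite /twist_tail -(copr_iter3_tens23 hΔ) -copr_iter3_copr_r //.
have hJ := copr_iter3_hom hΔ n.
have u23 := hom_unit hJ (hom_unit (@tens23_hom K A) uF).
have ur := hom_unit hJ (hom_unit (copr_r_hom hΔ) uF).
by rewrite unitrMl ?unitrMl; [exact: uG2 | exact: u23 | exact: ur].
Qed.

(** After conjugation by G_n ⊗ 1 ⊗ 1, the images of F_12 and (Δ ⊗ 1)F complete the left conjugator
    to G_(n+2), while the two inverse factors of Φ_F and the right conjugator form the inverse of
    [twist_tail]. *)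
Lemma coassoc_iter_twist n : coassoc_iter HF n.+2
  = G n.+2 * coassoc_iter H n.+2 * (twist_tail n)^-1.
Proof.
rewrite -[LHS]/(copr_iter3 HF n (coassoc HF)) copr_iter3_twist /=.
have hJ := copr_iter3_hom hΔ n; have [_ _ JM] := hJ.
have u23 := hom_unit (@tens23_hom K A) uF.
have ur := hom_unit (copr_r_hom hΔ) uF.
rewrite !JM (hom_inv hJ u23) (hom_inv (copr_r_hom hΔ) uF) (hom_inv hJ ur).
rewrite copr_iter3_tens12 // copr_iter3_copr_l // copr_iter3_tens23 //.
rewrite copr_iter3_copr_r // /twist_tail.
have u2 : tassoc ((1 : tpow A n) ⊗ F) \is a @GRing.unit (tpow A n.+2).
  by rewrite -(copr_iter3_tens23 hΔ) (hom_unit hJ).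
have u3 : tassoc (tmap (D n) (copr H) F) \is a @GRing.unit (tpow A n.+2).
  by rewrite -copr_iter3_copr_r // (hom_unit hJ).
have uGF := unitrMl (G n ⊗ (1 : A) ⊗ (1 : A) : tpow A n.+2) u2.
rewrite uG2 in uGF.
rewrite (invrM uGF u3) (invrM (uG2 n) u2).
have [_ _ tM] := tensl_hom (tpow A n.+1) A.
by rewrite /= tM !mulrA.
Qed.

(** Ř_F passes G_n, which sits on the other factors, becomes Ř on passing F, and then commutes with
    (Δ^(n) ⊗ Δ)F by [last_two_rcheck_comm]. *)
Lemma last_two_twist_tail n :
  last_two (rcheck pi HF) n.+1 *m ρ (twist_tail n)
  = ρ (twist_tail n) *m last_two (rcheck pi H) n.+1.
Proof.
have M (x y : tpow A n.+2) := tpow_rep_mul lpi piM x y.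
have E : G n ⊗ (1 : A) ⊗ (1 : A) = tassoc (G n ⊗ (1 : A ⊗ A)).
  by rewrite -tassoc_tens3.
rewrite /twist_tail E !M -!mulmxA -last_two_rcheck_comm //.
rewrite !mulmxA; congr (_ *m _).
rewrite !(tpow_rep_tassoc lpi) !last_twoS !last_site_mul.
by rewrite (tpow_rep1 lpi pi1 n) (tpow_rep1 lpi pi1 1) !(mul1mx, mulmx1) rcheck_twist.
Qed.

Lemma braid_gen_twist_last n :
  braid_gen pi HF n.+1 n.+1 *m ρ (G n.+1) = ρ (G n.+1) *m braid_gen pi H n.+1 n.+1.
Proof.
rewrite !braid_gen_last; case: n => [|n].
  rewrite /= invr1 -[tlift _ 1]/(ρ (1 : tpow A 1)) tpow_rep1 // !(mul1mx, mulmx1).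
  (* On two factors Φ_1 = 1 and G_1 = F, since Δ^(0) is the identity. *)
  rewrite tmap_id mul1r; exact: rcheck_twist.
have uW := twist_tail_unit n; have uJ := coassoc_iter_unit hΔ uΦ n.+2.
have M (x y : tpow A n.+2) := tpow_rep_mul lpi piM x y.
have uGJ : G n.+2 * coassoc_iter H n.+2 \is a GRing.unit.
  by rewrite unitrMl //; exact: uG.
have uWV : (twist_tail n)^-1 \is a GRing.unit by rewrite unitrV.
rewrite coassoc_iter_twist (invrM uGJ uWV) invrK (invrM (uG _) uJ).
set W := twist_tail n; set J := coassoc_iter H n.+2.
have E : ρ (W * (J^-1 * (G n.+2)^-1)) *m ρ (G n.+2) = ρ W *m ρ J^-1.
  by rewrite -!M -mulrA (mulrVK (uG n.+2)).
rewrite -mulmxA E (M _ W^-1) (M (G n.+2) J) -!mulmxA; congr (_ *m (_ *m _)).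
have L := last_two_twist_tail n; rewrite -/W in L.
rewrite (mulmxA (last_two _ _)) L !mulmxA.
by rewrite (tpow_rep_mulVl lpi pi1 piM uW) mul1mx.
Qed.

(** For a generator other than the last, induction handles the factor G_n ⊗ 1 of G_(n+1), and the
    factor (Δ^(n) ⊗ 1)F is crossed because the untwisted generator commutes with Δ^(n)(A). *)
Lemma braid_gen_twist n i : (0 < i <= n)%N ->
  braid_gen pi HF n i *m ρ (G n) = ρ (G n) *m braid_gen pi H n i.
Proof.
elim: n i => [|n IHn] i; first by case: i.
case/andP=> i0; rewrite leq_eqVlt ltnS => /predU1P[->|lin].
  exact: braid_gen_twist_last.
rewrite !(braid_gen_widen _ _ lpi pi1) //; last exact: coassoc_twist_unit.
have -> : ρ (G n.+1)
    = (ρ (G n) *t 1%:M) *m @tpow_rep K A d pi n.+1 (tmap (D n) id F).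
  have M := @tpow_rep_mul _ _ _ _ lpi piM n.+1.
  by rewrite -pi1 -(tpow_rep_tens lpi) -M.
have C b : braid_gen pi H n i *m ρ (D n b) = ρ (D n b) *m braid_gen pi H n i.
  by apply: braid_gen_comm; rewrite ?i0.
rewrite -mulmxA -(tens1_rep_comm qH lpi _ C) !mulmxA !tensmx_mul.
by rewrite IHn ?i0 // mul1mx.
Qed.

Lemma word_op_twist n (w : braid_word n) :
  word_op pi HF w *m ρ (G n) = ρ (G n) *m word_op pi H w.
Proof.
have ug : ρ (G n) \in unitmx.
  by case/mulmx1_unit: (tpow_rep_mulV lpi pi1 piM (uG n)).
rewrite /word_op; elim: w => [|[i b] w IHw]; first by rewrite !big_nil mul1mx mulmx1.
rewrite !big_cons /= -mulmxA IHw !mulmxA; congr (_ *m _).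
have C : braid_gen pi HF n i.+1 *m ρ (G n) = ρ (G n) *m braid_gen pi H n i.+1.
  by apply: braid_gen_twist; rewrite /= ltn_ord.
case: b => //; apply: invmx_intertwine => //.
(* As ρ(G_n) is invertible, [C] makes the two generators invertible simultaneously, as
   [invmx_intertwine] requires for inverse letters. *)
by have := congr1 (fun X => X \in unitmx) C; rewrite /= !unitmx_mul ug andbT.
Qed.

Lemma trace_word_op_twist n (w : braid_word n) a :
  \tr (word_op pi HF w *m ρ (DF n a)) = \tr (word_op pi H w *m ρ (D n a)).
Proof.
rewrite twist_copr_iter // !tpow_rep_mul // !mulmxA word_op_twist.
rewrite -!mulmxA mxtrace_mulC !mulmxA -(mulmxA _ (ρ _) (ρ (G n))).
by rewrite tpow_rep_mulVl // mulmx1.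
Qed.

End TwistIntertwiner.

(** The same [g] occurs on both sides, because u and v always come from the untwisted algebra; its
    link with the antipode is the relation S^2(a) g = g a. *)
Lemma theta_twist (K : fieldType) (A : unitAlgType K) (H : qha_data A)
    (F : A ⊗ A) (d : nat) (pi : A -> 'M[K]_d) (g : A) (n : nat)
    (w : braid_word n) :
  quasi_hopf H -> quasi_triangular H -> F \is a GRing.unit ->
  linear pi -> pi 1 = 1%:M -> (forall a b, pi (a * b) = pi a *m pi b) ->
  (forall a, antip H (antip H a) * g = g * a) ->
  theta pi (twist H F) g w = theta pi H g w.
Proof.
move=> qH tH uF lpi pi1 piM Sg; have hΔ := copr_hom qH.
rewrite /theta (trace_word_op_twist qH tH uF lpi pi1 piM).
pose chi a : K^o := \tr (word_op pi H w *m tpow_rep pi (copr_iter H n a)).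
have [lD _ DM] := copr_iter_hom hΔ n.
rewrite -/(chi _) -[RHS]/(chi _); apply: trace_twist_beta_alpha => // [c a b|a b].
  rewrite /chi lD (tpow_rep_linear lpi) mulmxDr -scalemxAr.
  by rewrite mxtraceD mxtraceZ.
rewrite /chi !DM !tpow_rep_mul // mulmxA word_op_comm // -mulmxA mxtrace_mulC.
by rewrite -mulmxA.
Qed.

Theorem mainTheorem2 (K : fieldType) (A : unitAlgType K) (H : qha_data A)
    (v : A) (d : nat) (pi : {lrmorphism A -> 'M[K]_d.+1}) (F : A ⊗ A) :
  quasi_hopf H -> quasi_triangular H -> ribbon H v ->
  irreducible pi -> is_scalar_mx (pi v) ->
  twistor H F ->
  forall (n : nat) (w : braid_word n), (1 <= n)%N ->
    theta pi (twist H F) (drinfeld_u H / v) w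
      = theta pi H (drinfeld_u H / v) w
    /\ forall zp zm p q : K,
         pi v^-1 = zp%:M -> pi v = zm%:M ->
         p ^+ 2 = zp * zm -> q ^+ 2 = zm / zp ->
         link_poly pi p q (twist H F) (drinfeld_u H / v) w
           = link_poly pi p q H (drinfeld_u H / v) w.
Proof.
move=> qH tH rv _ _ tF n w _.
have E : theta pi (twist H F) (drinfeld_u H / v) w
    = theta pi H (drinfeld_u H / v) w.
  apply: theta_twist => //.
  - exact: twistor_unit tF.
  - by move=> c a b; rewrite linearP.
  - exact: rmorph1.
  - exact: rmorphM.
  (* The relation for u v^-1 follows from S^2(a) u = u a by moving [a] past the central v^-1. *)
  move=> a; have va : GRing.comm a v^-1.
    by apply: commrV; apply/esym/(ribbon_central rv).
  by rewrite mulrA antip_antip_u // -!mulrA va.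
by split=> // zp zm p q _ _ _ _; rewrite /link_poly E.
Qed.
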